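(* Let $G$ be a finite group scheme over a field $k$ of characteristic $p>2$, and choose positive integers $m>n$, $m_1,\dots,m_m$ all odd, $n_1,\dots,n_n$ all even. Choose Tate cohomology classes $\zeta_{i,j}\in\widehat{H}^{m_j-n_i}(G,k)$ and let $\hat\zeta_{i,j}:\Omega^{m_j}(k)\to\Omega^{n_i}(k)$ represent $\zeta_{i,j}$ ($1\le i\le n$, $1\le j\le m$). Consider an exact sequence of $kG$-modules $$0\to L\to M\xrightarrow{\ \varphi=(\hat\zeta_{i,j})\ }N\to 0,$$ where $$M\cong\bigoplus_{j=1}^m\Omega^{m_j}(k)\oplus(\mathrm{proj}),\qquad N\cong\bigoplus_{i=1}^n\Omega^{n_i}(k).$$ Assume that for every $\pi$-point $\alpha_K:K[t]/t^p\to KG$, the restriction of the matrix of cohomology elements $(\alpha_K^*(\zeta_{i,j}))\in M_{n,m}(\widehat{H}^*(K[t]/t^p,K))$ has rank $n$. Then the module $L$ has stable constant Jordan type $(m-n)[p-1]+n[p-2]$.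
   Context: $k$ is a field of characteristic $p>2$. A finite group scheme $G$ over $k$ is a group scheme whose coordinate algebra $k[G]$ is finite dimensional; its group algebra $kG$ is the linear dual of $k[G]$. All $kG$-modules are finitely generated. For a field extension $K/k$, $KG=K\otimes_k kG$ is the group algebra of $G_K=G\times_{\mathrm{Spec}\,k}\mathrm{Spec}\,K$, and $M_K=K\otimes_k M$. A $\pi$-point of $G$ is a left flat map of $K$-algebras $\alpha_K:K[t]/t^p\to KG$, for some field extension $K/k$, which factors through the group algebra $KC_K\subset KG$ of some unipotent abelian subgroup scheme $C_K\subset G_K$; $\alpha_K^*$ denotes restriction along $\alpha_K$ (of modules, and of Tate cohomology classes after base change to $K$). Every finite dimensional $K[t]/t^p$-module is a direct sum of $a_i$ copies of the indecomposables $[i]=K[t]/t^i$, $1\le i\le p$; its Jordan type is $a_p[p]+\cdots+a_1[1]$, and its stable Jordan type is the same expression with the coefficient of $[p]$ disregarded. A finite dimensional $kG$-module has constant Jordan type if the Jordan type of its restriction $\alpha_K^*(M_K)$ is the same for all $\pi$-points; it has stable constant Jordan type $\underline a$ if it has constant Jordan type with stable Jordan type $\underline a$. $\Omega^i(k)$ is the $i$-th Heller shift of the trivial module ($\Omega^1$ = kernel of projective cover, $\Omega^{-1}$ = cokernel of injective hull, iterated). $\widehat{H}^*(G,k)=\widehat{\mathrm{Ext}}^*_{kG}(k,k)$ is Tate cohomology; $\widehat{H}^{a-b}(G,k)\cong\mathrm{Hom}_{\mathrm{stmod}(kG)}(\Omega^a(k),\Omega^b(k))$, where $\mathrm{stmod}(kG)$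 is the stable module category, and a homomorphism $\Omega^a(k)\to\Omega^b(k)$ represents a class if its stable class is that element. ''(proj)'' denotes some (possibly zero) projective $kG$-module, and the notation $\varphi=(\hat\zeta_{i,j})$ means that the component of $\varphi$ from the summand $\Omega^{m_j}(k)$ to the summand $\Omega^{n_i}(k)$ is $\hat\zeta_{i,j}$. For $p>2$, $\widehat H^*(K[t]/t^p,K)=K[x,x^{-1}]\otimes\Lambda(\eta)$ with $x$ of degree 2 and $\eta$ of degree 1; all entries of the matrix here have odd degree, hence are scalars times $\eta x^s$, and the rank of the matrix means the rank of the resulting matrix of scalars. *)

(* Defs.v *)
From mathcomp Require Import all_boot all_order all_algebra.

Set Implicit Arguments.
Unset Strict Implicit.
Unset Printing Implicit Defensive.

Import GRing.Theory.
Local Open Scope ring_scope.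

(* A finite group scheme G over F is encoded by its coordinate algebra F[G], a
   finite dimensional commutative Hopf algebra, written in a basis e_0, e_1, ...
   (so that extension of scalars acts on structure constants):
     e_i e_j   = \sum_l gmul i j l e_l,     1   = \sum_l gone l e_l,
     Delta e_i = \sum_(a, b) gcom i a b (e_a (x) e_b),     eps e_i = gcou i,
     S e_i     = \sum_l gant i l e_l.                                         *)
Record fgscheme (F : fieldType) := FGScheme {
  gdim : nat;
  gmul : 'I_gdim -> 'I_gdim -> 'I_gdim -> F;
  gone : 'I_gdim -> F;
  gcom : 'I_gdim -> 'I_gdim -> 'I_gdim -> F;
  gcou : 'I_gdim -> F;
  gant : 'I_gdim -> 'I_gdim -> F;
  gmulA : forall i j l r,
    \sum_s gmul i j s * gmul s l r = \sum_s gmul j l s * gmul i s r;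
  gmulC : forall i j l, gmul i j l = gmul j i l;
  gmul1 : forall i j, \sum_s gone s * gmul s i j = (i == j)%:R;
  gcomA : forall i a b c,
    \sum_s gcom i s c * gcom s a b = \sum_s gcom i a s * gcom s b c;
  gcomL : forall i a, \sum_s gcou s * gcom i s a = (i == a)%:R;
  gcomR : forall i a, \sum_s gcom i a s * gcou s = (i == a)%:R;
  gcomM : forall i j a b,
    \sum_s gmul i j s * gcom s a b =
    \sum_i1 \sum_i2 \sum_j1 \sum_j2
      gcom i i1 i2 * gcom j j1 j2 * (gmul i1 j1 a * gmul i2 j2 b);
  gcom1 : forall a b, \sum_s gone s * gcom s a b = gone a * gone b;
  gcouM : forall i j, \sum_s gmul i j s * gcou s = gcou i * gcou j;
  gcou1 : \sum_s gone s * gcou s = 1;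
  gantL : forall i r,
    \sum_a \sum_b \sum_s gcom i a b * gant a s * gmul s b r = gcou i * gone r;
  gantR : forall i r,
    \sum_a \sum_b \sum_s gcom i a b * gant b s * gmul a s r = gcou i * gone r
}.

Section BaseChange.
Variables (k K : fieldType) (iota : {rmorphism k -> K}) (G : fgscheme k).

(* G_K = G x_{Spec k} Spec K *)
Definition base_change : fgscheme K.
Proof.
apply: (@FGScheme K (gdim G) (fun i j l => iota (gmul i j l))
  (fun i => iota (gone i)) (fun i j l => iota (gcom i j l))
  (fun i => iota (gcou i)) (fun i j => iota (gant i j))).
- move=> i j l r; under eq_bigr do rewrite -rmorphM.
  rewrite -rmorph_sum gmulA rmorph_sum.
  by apply: eq_bigr => s _; rewrite rmorphM.
- by move=> i j l; rewrite gmulC.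
- move=> i j; under eq_bigr do rewrite -rmorphM.
  by rewrite -rmorph_sum gmul1 rmorph_nat.
- move=> i a b c; under eq_bigr do rewrite -rmorphM.
  rewrite -rmorph_sum gcomA rmorph_sum.
  by apply: eq_bigr => s _; rewrite rmorphM.
- move=> i a; under eq_bigr do rewrite -rmorphM.
  by rewrite -rmorph_sum gcomL rmorph_nat.
- move=> i a; under eq_bigr do rewrite -rmorphM.
  by rewrite -rmorph_sum gcomR rmorph_nat.
- move=> i j a b; under eq_bigr do rewrite -rmorphM.
  rewrite -rmorph_sum gcomM rmorph_sum; apply: eq_bigr => i1 _.
  rewrite rmorph_sum; apply: eq_bigr => i2 _.
  rewrite rmorph_sum; apply: eq_bigr => j1 _.
  by rewrite rmorph_sum; apply: eq_bigr => j2 _; rewrite !rmorphM.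
- move=> a b; under eq_bigr do rewrite -rmorphM.
  by rewrite -rmorph_sum gcom1 rmorphM.
- move=> i j; under eq_bigr do rewrite -rmorphM.
  by rewrite -rmorph_sum gcouM rmorphM.
- under eq_bigr do rewrite -rmorphM.
  by rewrite -rmorph_sum gcou1 rmorph1.
- move=> i r; have := congr1 iota (gantL i r); rewrite rmorphM => <-.
  rewrite rmorph_sum; apply: eq_bigr => a _.
  rewrite rmorph_sum; apply: eq_bigr => b _.
  by rewrite rmorph_sum; apply: eq_bigr => s _; rewrite !rmorphM.
- move=> i r; have := congr1 iota (gantR i r); rewrite rmorphM => <-.
  rewrite rmorph_sum; apply: eq_bigr => a _.
  rewrite rmorph_sum; apply: eq_bigr => b _.
  by rewrite rmorph_sum; apply: eq_bigr => s _; rewrite !rmorphM.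
Defined.

End BaseChange.

Section GroupAlgebra.
Variables (F : fieldType) (G : fgscheme F).

(* The group algebra FG, the linear dual of F[G]: x : 'rV_(gdim G) stands for
   the functional sending e_i to x 0 i, and the product is dual to Delta, so
   that on the dual basis e*_i e*_j = \sum_l gcom l i j e*_l.                 *)
Definition kgmul (x y : 'rV[F]_(gdim G)) : 'rV[F]_(gdim G) :=
  \row_l \sum_i \sum_j x 0 i * y 0 j * gcom l i j.
Definition kgone : 'rV[F]_(gdim G) := \row_l gcou l.
Definition kgexp (x : 'rV[F]_(gdim G)) (n : nat) := iter n (kgmul x) kgone.

(* Finite dimensional left FG-modules: mact i is the matrix, acting on column
   vectors, of the dual basis element e*_i.                                   *)
Record gmod := GMod {
  mdim : nat;
  mact : 'I_(gdim G) -> 'M[F]_mdim;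
  mactM : forall i j, mact i *m mact j = \sum_l gcom l i j *: mact l;
  mact1 : \sum_l gcou l *: mact l = 1%:M
}.

Definition kgact (M : gmod) (x : 'rV[F]_(gdim G)) : 'M[F]_(mdim M) :=
  \sum_i x 0 i *: mact M i.

(* The augmentation of FG is x |-> x(1), so e*_i acts on the trivial module by
   gone i.                                                                    *)
Definition trivial_mod : gmod.
Proof.
apply: (@GMod 1 (fun i => (gone i)%:M)).
- move=> i j; rewrite -scalar_mxM -gcom1 raddf_sum; apply: eq_bigr => l _.
  by rewrite scale_scalar_mx mulrC.
- rewrite -(gcou1 G) raddf_sum; apply: eq_bigr => l _.
  by rewrite scale_scalar_mx mulrC.
Defined.

Definition regular_mod : gmod.
Proof.
apply: (@GMod (gdim G) (fun i => \matrix_(r, s) gcom r i s)).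
- move=> i j; apply/matrixP => r s; rewrite mxE summxE.
  under eq_bigr do rewrite !mxE; rewrite -gcomA; apply: eq_bigr => l _.
  by rewrite !mxE mulrC.
- apply/matrixP => r s; rewrite summxE mxE -gcomL.
  by apply: eq_bigr => l _; rewrite !mxE.
Defined.

Lemma mul_mxdiag n (p_ : 'I_n -> nat) (A B : forall i, 'M[F]_(p_ i)) :
  \mxdiag_i A i *m \mxdiag_i B i = \mxdiag_i (A i *m B i).
Proof.
rewrite {2}/mxdiag mul_mxdiag_mxblock; apply/eq_mxblockP => i j.
case: eqP => [e|]; last by rewrite mulmx0.
by case: j / e; rewrite !conform_mx_id.
Qed.

Lemma mxdiag_lincomb n (p_ : 'I_n -> nat) d (c : 'I_d -> F)
    (A : 'I_d -> forall i, 'M[F]_(p_ i)) :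
  \sum_l c l *: \mxdiag_i A l i = \mxdiag_i (\sum_l c l *: A l i).
Proof.
rewrite mxdiag_sum; apply: eq_bigr => l _.
rewrite -mul_scalar_mx -(@mxdiagZ _ _ p_) mul_mxdiag.
by apply: eq_mxdiag => i; rewrite mul_scalar_mx.
Qed.

Lemma block_lincomb a b d (c : 'I_d -> F) (A : 'I_d -> 'M[F]_a)
    (B : 'I_d -> 'M[F]_b) :
  \sum_l c l *: block_mx (A l) 0 0 (B l) =
  block_mx (\sum_l c l *: A l) 0 0 (\sum_l c l *: B l).
Proof.
elim/big_rec3: _ => [|l y1 y2 y3 _ ->]; first by rewrite block_mx0.
by rewrite scale_block_mx !scaler0 add_block_mx !addr0.
Qed.

Definition big_dsum n (Ms : 'I_n -> gmod) : gmod.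
Proof.
apply: (@GMod (\sum_j mdim (Ms j)) (fun i => \mxdiag_j mact (Ms j) i)).
- move=> i j; rewrite mul_mxdiag mxdiag_lincomb.
  by apply: eq_mxdiag => r; rewrite mactM.
- rewrite mxdiag_lincomb -(@mxdiagZ _ _ (fun j => mdim (Ms j))).
  by apply: eq_mxdiag => r; rewrite mact1.
Defined.

Definition dsum (M N : gmod) : gmod.
Proof.
apply: (@GMod (mdim M + mdim N)
          (fun i => block_mx (mact M i) 0 0 (mact N i))).
- move=> i j; rewrite mulmx_block !mulmx0 !mul0mx !addr0 add0r.
  by rewrite block_lincomb !mactM.
- by rewrite block_lincomb !mact1 -scalar_mx_block.
Defined.

Definition ghom (M N : gmod) (f : 'M[F]_(mdim N, mdim M)) : Prop :=
  forall i, f *m mact M i = mact N i *m f.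

End GroupAlgebra.

Section LinearMaps.
Variable F : fieldType.

Definition inj_mx a b (f : 'M[F]_(b, a)) : Prop :=
  forall v : 'cV_a, f *m v = 0 -> v = 0.
Definition surj_mx a b (f : 'M[F]_(b, a)) : Prop :=
  forall w : 'cV_b, exists v : 'cV_a, f *m v = w.
Definition inverse_mx a b (f : 'M[F]_(b, a)) (g : 'M[F]_(a, b)) : Prop :=
  f *m g = 1%:M /\ g *m f = 1%:M.

End LinearMaps.

Section Modules.
Variables (F : fieldType) (G : fgscheme F).
Implicit Types M N P Q X Y : gmod G.

Definition giso M N (f : 'M[F]_(mdim N, mdim M)) : Prop :=
  ghom f /\ exists g, inverse_mx f g.

Definition short_exact M N P
    (f : 'M[F]_(mdim N, mdim M)) (g : 'M[F]_(mdim P, mdim N)) : Prop :=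
  [/\ ghom f, ghom g, inj_mx f, surj_mx g &
      forall v : 'cV_(mdim N), g *m v = 0 <-> exists u, v = f *m u].

Definition projective P : Prop :=
  forall X Y (g : 'M_(mdim Y, mdim X)) (f : 'M_(mdim Y, mdim P)),
    ghom g -> surj_mx g -> ghom f -> exists2 h, @ghom F G P X h & g *m h = f.

Definition injective_mod Q : Prop :=
  forall X Y (g : 'M_(mdim Y, mdim X)) (f : 'M_(mdim Q, mdim X)),
    ghom g -> inj_mx g -> ghom f -> exists2 h, @ghom F G Y Q h & h *m g = f.

Definition projective_cover P M (f : 'M[F]_(mdim M, mdim P)) : Prop :=
  [/\ projective P, ghom f, surj_mx f &
      forall X (h : 'M_(mdim P, mdim X)),
        ghom h -> surj_mx (f *m h) -> surj_mx h].

Definition injective_hull M Q (f : 'M[F]_(mdim Q, mdim M)) : Prop :=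
  [/\ injective_mod Q, ghom f, inj_mx f &
      forall X (h : 'M_(mdim X, mdim Q)),
        ghom h -> inj_mx (h *m f) -> inj_mx h].

(* Equality in stmod(FG). *)
Definition stable_eq M N (f g : 'M[F]_(mdim N, mdim M)) : Prop :=
  exists Q (a : 'M_(mdim Q, mdim M)) (b : 'M_(mdim N, mdim Q)),
    [/\ projective Q, ghom a, ghom b & f - g = b *m a].

(* A minimal complete resolution of the trivial module: the sequences
   0 -> Om (i + 1) -> Pr i -> Om i -> 0 are exact, they are given by projective
   covers for i >= 0 and by injective hulls for i < 0, and Om 0 is the trivial
   module (through aug).  Hence Om i is the i-th Heller shift for all i : int. *)
Record complete_res := CompleteRes {
  Om : int -> gmod G;
  Pr : int -> gmod G;
  inc : forall i, 'M[F]_(mdim (Pr i), mdim (Om (i + 1)));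
  cov : forall i, 'M[F]_(mdim (Om i), mdim (Pr i));
  aug : 'M[F]_(mdim (trivial_mod G), mdim (Om 0));
  res_aug : giso aug;
  res_exact : forall i, short_exact (inc i) (cov i);
  res_proj : forall i, projective (Pr i);
  res_cover : forall i, 0 <= i -> projective_cover (cov i);
  res_hull : forall i, i < 0 -> injective_hull (inc i)
}.

Variable R : complete_res.

Definition diff (i : int) : 'M[F]_(mdim (Pr R i), mdim (Pr R (i + 1))) :=
  inc R i *m cov R (i + 1).

(* A degree d chain self-map of Pr; the component f u v : Pr u -> Pr v matters
   only when u - v = d.                                                       *)
Definition chain_map d
    (f : forall u v : int, 'M[F]_(mdim (Pr R v), mdim (Pr R u))) : Prop :=
  forall u v, u - v = d ->
    ghom (f u v) /\ diff v *m f (u + 1) (v + 1) = f u v *m diff u.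

(* An element of the Tate cohomology group of degree d is an element of
   Hom_stmod(Om d, k), given by a homomorphism z : Om d -> k taken up to
   stable_eq.  A homomorphism zh : Om a -> Om b represents the class of z in
   degree d = a - b if the class of zh corresponds to that of z under the shift
   isomorphism Hom_stmod(Om a, Om b) ~ Hom_stmod(Om (a - b), Om 0): a chain
   map extending zh induces w : Om (a - b) -> Om 0 ~ k stably equal to z.     *)
Definition represents a b (zh : 'M[F]_(mdim (Om R b), mdim (Om R a)))
    (z : 'M[F]_(mdim (trivial_mod G), mdim (Om R (a - b)))) : Prop :=
  exists f w,
    [/\ chain_map (a - b) f,
        cov R b *m f a b = zh *m cov R a,
        aug R *m cov R 0 *m f (a - b) 0 = w *m cov R (a - b) &
        stable_eq w z].

End Modules.

Section BaseChangeModule.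
Variables (k K : fieldType) (iota : {rmorphism k -> K}).

Definition base_change_mod (G : fgscheme k) (M : gmod G) :
  gmod (base_change iota G).
Proof.
apply: (@GMod K (base_change iota G) (mdim M)
          (fun i => map_mx iota (mact M i))).
- move=> i j; rewrite -map_mxM mactM map_mx_sum.
  by apply: eq_bigr => l _; rewrite map_mxZ.
- rewrite -(map_mx1 iota) -mact1 map_mx_sum.
  by apply: eq_bigr => l _; rewrite map_mxZ.
Defined.

End BaseChangeModule.

Section Subgroups.
Variables (F : fieldType) (G C : fgscheme F).

(* r is the restriction map F[G] -> F[C] of a closed embedding C -> G: a
   surjective map of Hopf algebras, e_i being sent to \sum_j r i j e_j.
   (Maps of bialgebras preserve antipodes.)                                   *)
Definition closed_subgroup (r : 'M[F]_(gdim G, gdim C)) : Prop :=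
  [/\ forall i j c, \sum_l gmul i j l * r l c =
        \sum_a \sum_b r i a * r j b * gmul a b c,
      forall c, \sum_l gone l * r l c = gone c,
      forall i c d, \sum_a \sum_b gcom i a b * (r a c * r b d) =
        \sum_l r i l * gcom l c d,
      forall i, \sum_l r i l * gcou l = gcou i &
      forall w : 'rV_(gdim C), exists u : 'rV_(gdim G), u *m r = w].

End Subgroups.

Definition abelian_scheme (F : fieldType) (C : fgscheme F) : Prop :=
  forall i a b : 'I_(gdim C), gcom i a b = gcom i b a.

(* Every nonzero representation has a nonzero fixed vector. *)
Definition unipotent_scheme (F : fieldType) (C : fgscheme F) : Prop :=
  forall M : gmod C, (0 < mdim M)%N ->
    exists2 v : 'cV[F]_(mdim M), v != 0 & forall i, mact M i *m v = gone i *: v.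

Section KT.
Variables (p : nat) (K : fieldType).

(* A finite dimensional K[t]/t^p-module is a square matrix T, the action of t
   on column vectors, such that T ^+ p = 0.                                   *)

(* The module [s] = K[t]/t^s in the basis 1, t, ..., t^(s-1). *)
Definition jblock (s : nat) : 'M[K]_s := \matrix_(i, j) (i == j.+1 :> nat)%:R.

(* jordan_type T c: T is isomorphic to the direct sum of c i copies of [i],
   1 <= i <= p; s lists the sizes of the blocks.                              *)
Definition jordan_type n (T : 'M[K]_n) (c : nat -> nat) : Prop :=
  exists s : seq nat,
    [/\ all (fun i => (0 < i <= p)%N) s,
        forall i, (0 < i <= p)%N -> count_mem i s = c i &
        exists (g : 'M_(\sum_(l < size s) nth 0%N s l, n)) h,
          inverse_mx g h /\
          g *m T = (\mxdiag_(l < size s) jblock (nth 0%N s l)) *m g].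

(* Flatness over K[t]/t^p: X (x)_K[t] F is the space of matrices Z = X (x)_K F
   modulo those of the form (t x) (x) f - x (x) (t f), and f (x)_K[t] F has to
   be injective whenever f is.                                                *)
Definition flat n (T : 'M[K]_n) : Prop :=
  forall a b (A : 'M[K]_a) (B : 'M[K]_b) (f : 'M[K]_(b, a)),
    A ^+ p = 0 -> B ^+ p = 0 -> f *m A = B *m f -> inj_mx f ->
    forall Z : 'M[K]_(a, n),
      (exists W, f *m Z = B *m W - W *m T^T) ->
      exists W, Z = A *m W - W *m T^T.

End KT.

Section PiPoints.
Variables (p : nat) (k : fieldType) (G : fgscheme k).

(* A map of K-algebras K[t]/t^p -> KG is given by the image x of t, an element
   with x^p = 0.  The group algebra map dual to r : K[G] -> K[C] is
   y |-> y *m r^T.                                                            *)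
Definition pi_point (K : fieldType) (iota : {rmorphism k -> K})
    (x : 'rV[K]_(gdim (base_change iota G))) : Prop :=
  [/\ kgexp x p = 0,
      flat p (kgact (regular_mod (base_change iota G)) x) &
      exists (C : fgscheme K)
             (r : 'M[K]_(gdim (base_change iota G), gdim C)),
        [/\ closed_subgroup r, abelian_scheme C, unipotent_scheme C &
            exists y : 'rV_(gdim C), x = y *m r^T]].

(* alpha_K^*(M_K), as the matrix by which t acts *)
Definition restriction (K : fieldType) (iota : {rmorphism k -> K})
    (x : 'rV[K]_(gdim (base_change iota G))) (M : gmod G) : 'M[K]_(mdim M) :=
  kgact (base_change_mod iota M) x.

Definition constant_jordan_type (M : gmod G) (c : nat -> nat) : Prop :=
  forall (K : fieldType) (iota : {rmorphism k -> K}) x,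
    @pi_point K iota x -> jordan_type p (restriction x M) c.

Definition stable_constant_jordan_type (M : gmod G) (c : nat -> nat) : Prop :=
  exists2 c', constant_jordan_type M c' &
    forall i, (0 < i < p)%N -> c' i = c i.

Variable R : complete_res G.

(* The periodic complete resolution of K over K[t]/t^p has K[t]/t^p in every
   degree; its differential from degree i + 1 to degree i is t for i even and
   t^(p-1) for i odd.                                                         *)
Definition kt_diff (K : fieldType) (i : int) : 'M[K]_p :=
  if (2 %| i)%Z then jblock K p else jblock K p ^+ p.-1.

(* A map of complete resolutions, over the identity of K, from the periodic
   one to alpha_K^* of Pr_K.                                                  *)
Definition comparison (K : fieldType) (iota : {rmorphism k -> K})
    (x : 'rV[K]_(gdim (base_change iota G)))
    (th : forall i : int, 'M[K]_(mdim (Pr R i), p)) : Prop :=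
  [/\ forall i, th i *m jblock K p = restriction x (Pr R i) *m th i,
      forall i, th i *m kt_diff K i = map_mx iota (diff R i) *m th (i + 1) &
      map_mx iota (aug R *m cov R 0) *m th 0 = \row_s (s == 0 :> nat)%:R].

(* The restriction along alpha_K of the class of z : Om d -> k has cocycle
   z \o cov d \o th d : K[t]/t^p -> K.  All differentials of
   Hom(periodic resolution, K) vanish, so the class is the value at 1 of this
   cocycle, as a multiple of the class with value 1, which is x^s if d = 2s and
   eta x^s if d = 2s + 1.                                                     *)
Definition restriction_coef (K : fieldType) (iota : {rmorphism k -> K})
    (th : forall i : int, 'M[K]_(mdim (Pr R i), p)) (d : int)
    (z : 'M[k]_(mdim (trivial_mod G), mdim (Om R d))) : K :=
  (map_mx iota (z *m cov R d) *m th d *m \col_s (s == 0 :> nat)%:R)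
    (ord0 : 'I_1) 0.

End PiPoints.

(* Main.v *)
Require Import Defs.
From mathcomp Require Import all_boot all_order all_algebra.
From mathcomp Require Import zify.

Set Implicit Arguments.
Unset Strict Implicit.
Unset Printing Implicit Defensive.

Import GRing.Theory.
Local Open Scope ring_scope.

(** Restricting along a pi-point turns every module into a vector space with a
    nilpotent operator T, T^p = 0, and everything is decided there.

    Since KG is flat over K[t]/t^p, projective modules restrict to free ones.
    Hence the Heller shift Omega^d(k) restricts to [1] + free for d even and to
    [p-1] + free for d odd, and the image of 1 under the comparison of complete
    resolutions gives a generator u_d of the non-free block.  The statement
    that V is [s]^q + free, with the columns of U generating the non-free
    blocks, is captured by the four exactness conditions of [stable_blocks].
    They avoid choosing a complement, pass to direct sums
    ([stable_blocks_direct_sum]), and hold at one end of a short exact sequence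
    with free middle term iff they hold at the other end with s replaced by p-s
    ([stable_blocks_syzygy], [stable_blocks_quotient]); so starting from
    Omega^0(k) = k one gets all Omega^d(k) ([stable_blocks_Om]).

    A chain map of odd degree carries the generator of each odd or even block
    to a multiple of the generator, respectively the socle, of the block in the
    target.  The multiple does not depend on the degree ([chain_coefS]).  In
    target degree 0 it is the restriction of the Tate class, so the matrix of
    scalars of the hypothesis is the matrix C such that phi U = W C modulo t N,
    with U and W the generators for M and N ([represents_heller_elt]).

    Linear algebra finishes the proof ([jordan_type_kernel]).  Correcting U by
    an element of t M makes phi U = W C exact.  As C has rank n, m - n
    combinations of U lie in L and generate blocks [p-1], while n further
    combinations map onto W, and their multiples by t lie in L and generate
    blocks [p-2].  Together with generators of free blocks they generate L
    modulo t L and have independent socles, which forces L to be the direct sum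
    of the cyclic modules they generate ([chains_basis]).  The number of free
    blocks is then determined by dim L, hence is the same at every pi-point. *)

(** * Linear maps and exactness *)

Section LinearAlgebra.
Variable F : fieldType.

Lemma mul_expmxD n q (T : 'M[F]_n) i j (v : 'M_(n, q)) :
  T ^+ i *m (T ^+ j *m v) = T ^+ (i + j) *m v.
Proof. by rewrite mulmxA exprD. Qed.

Lemma mul_expmxS n q (T : 'M[F]_n) i (v : 'M_(n, q)) :
  T *m (T ^+ i *m v) = T ^+ i.+1 *m v.
Proof. by rewrite mulmxA exprS. Qed.

Lemma mul_expmxSr n q (T : 'M[F]_n) i (v : 'M_(n, q)) :
  T ^+ i *m (T *m v) = T ^+ i.+1 *m v.
Proof. by rewrite mulmxA exprSr. Qed.

Lemma mul_expmx_ge p n q (T : 'M[F]_n) i (v : 'M_(n, q)) :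
  T ^+ p = 0 -> (p <= i)%N -> T ^+ i *m v = 0.
Proof. by move=> Tp0 /subnK <-; rewrite exprD Tp0 mulr0 mul0mx. Qed.

Lemma intertwineX a b (f : 'M[F]_(b, a)) A B i :
  f *m A = B *m f -> f *m A ^+ i = B ^+ i *m f.
Proof.
move=> fAB; elim: i => [|i IHi]; first by rewrite !expr0 mulmx1 mul1mx.
by rewrite !exprS -!mulmxE mulmxA fAB -mulmxA IHi mulmxA.
Qed.

Lemma intertwineXv a b (f : 'M[F]_(b, a)) A B i q (v : 'M_(a, q)) :
  f *m A = B *m f -> f *m (A ^+ i *m v) = B ^+ i *m (f *m v).
Proof. by move=> fAB; rewrite mulmxA (intertwineX i fAB) mulmxA. Qed.

Lemma matrix_of_columns a b q (A : 'M[F]_(b, a)) (B : 'M[F]_(b, q)) :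
  (forall j, exists v, A *m v = col j B) -> exists X, A *m X = B.
Proof.
move=> /fin_all_exists[v Av]; exists (\matrix_(i, j) v j i 0).
apply/matrixP => i j; have /matrixP/(_ i 0) := Av j; rewrite !mxE => <-.
by apply: eq_bigr => l _; rewrite !mxE.
Qed.

Lemma inj_mx_cancel a b q (f : 'M[F]_(b, a)) (X Y : 'M_(a, q)) :
  inj_mx f -> f *m X = f *m Y -> X = Y.
Proof.
move=> inj_f fXY; apply/eqP; rewrite -subr_eq0; apply/eqP/matrixP => i j.
have /inj_f/matrixP/(_ i 0) : f *m col j (X - Y) = 0.
  by rewrite colE mulmxA -colE mulmxBr fXY subrr col0.
by rewrite !mxE.
Qed.

Definition exact_pair a b c (f : 'M[F]_(b, a)) (g : 'M[F]_(c, b)) : Prop :=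
  [/\ inj_mx f, surj_mx g & forall v : 'cV_b, g *m v = 0 <-> exists u, v = f *m u].

(** Exactness in equational form: unlike the quantified conditions over vectors,
    equations between matrices survive extension of scalars. *)
Definition split_pair a b c (f : 'M[F]_(b, a)) (g : 'M[F]_(c, b)) : Prop :=
  exists r s, [/\ r *m f = 1%:M, g *m s = 1%:M, g *m f = 0 & f *m r + s *m g = 1%:M].

Lemma exact_split a b c (f : 'M[F]_(b, a)) (g : 'M[F]_(c, b)) :
  exact_pair f g <-> split_pair f g.
Proof.
split=> [[inj_f surj_g exact_fg] | [r [s [rf gs gf frsg]]]].
  have gf : g *m f = 0.
    apply/matrixP => i j; have /exact_fg : exists u, col j f = f *m u.
      by exists (delta_mx j 0); rewrite colE.
    by rewrite colE mulmxA -colE => /matrixP/(_ i 0); rewrite !mxE.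
  have [s gs] : exists s, g *m s = 1%:M by apply: matrix_of_columns => j.
  have [r fr] : exists r, f *m r = 1%:M - s *m g.
    apply: matrix_of_columns => j.
    have /exact_fg[u ->] : g *m col j (1%:M - s *m g) = 0.
      by rewrite colE mulmxA mulmxBr mulmx1 mulmxA gs mul1mx subrr mul0mx.
    by exists u.
  exists r, s; split=> //; last by rewrite fr subrK.
  apply: (inj_mx_cancel inj_f).
  by rewrite mulmxA fr mulmxBl mul1mx -mulmxA gf mulmx0 subr0 mulmx1.
split=> [v fv0 | w | v].
- by rewrite -[v]mul1mx -rf -mulmxA fv0 mulmx0.
- by exists (s *m w); rewrite mulmxA gs mul1mx.
split=> [gv0 | [u ->]]; last by rewrite mulmxA gf mul0mx.
exists (r *m v); rewrite mulmxA -[LHS]mul1mx -frsg mulmxDl -[X in _ + X]mulmxA.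
by rewrite gv0 mulmx0 addr0.
Qed.

End LinearAlgebra.

Lemma exact_pair_map (k K : fieldType) (iota : {rmorphism k -> K}) a b c
    (f : 'M[k]_(b, a)) (g : 'M[k]_(c, b)) :
  exact_pair f g -> exact_pair (map_mx iota f) (map_mx iota g).
Proof.
move=> /exact_split[r [s [rf gs gf frsg]]]; apply/exact_split.
exists (map_mx iota r), (map_mx iota s).
by rewrite -!map_mxM -map_mxD rf gs gf frsg !map_mx1 map_mx0.
Qed.

(** * Modules that are free up to copies of one block *)

Section Blocks.
Variables (K : fieldType) (p : nat).

(** Of the conditions ker T^i = im T^(p-i), which characterize the free
    K[t]/t^p-modules, the one that flatness gives; it implies the others
    ([free_ker]). *)
Definition free_op n (T : 'M[K]_n) : Prop :=
  T ^+ p = 0 /\ forall v : 'cV_n, T ^+ p.-1 *m v = 0 -> exists y, v = T *m y.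

(** A vector killed by T^s is killed by T^(p-1), so it can be divided by T, and
    the quotient, killed by T^(s+1), can be divided again as long as the
    exponent stays below p. *)
Lemma free_ker n (T : 'M[K]_n) s (v : 'cV_n) :
  free_op T -> (0 < s <= p)%N -> T ^+ s *m v = 0 ->
  exists y, v = T ^+ (p - s) *m y.
Proof.
move=> [_ Tfree] s_p Tsv.
suff: forall i, (i <= p - s)%N -> exists y, v = T ^+ i *m y by apply.
elim=> [_|i IHi lti]; first by exists v; rewrite expr0 mul1mx.
have [y Dv] := IHi (ltnW lti).
have [|z Dy] := Tfree y; last by exists z; rewrite Dv Dy mul_expmxSr.
have ->: p.-1 = (p.-1 - (s + i) + (s + i))%N by lia.
by rewrite -mul_expmxD -[X in _ *m X]mul_expmxD -Dv Tsv mulmx0.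
Qed.

(** (K^n, T) is [s]^q + free, the columns of U generating the copies of [s].
    The second and third conditions say that the Tate cohomology groups
    ker T^s / im T^(p-s) and ker T^(p-s) / im T^s are spanned by the generators
    and by their socles, the last one that the socles are independent in the
    latter group. *)
Definition stable_blocks s n q (T : 'M[K]_n) (U : 'M[K]_(n, q)) : Prop :=
  [/\ T ^+ s *m U = 0,
      forall v : 'cV_n, T ^+ s *m v = 0 ->
        exists y a, v = T ^+ (p - s) *m y + U *m a,
      forall v : 'cV_n, T ^+ (p - s) *m v = 0 ->
        exists y a, v = T ^+ s *m y + T ^+ s.-1 *m (U *m a) &
      forall (a : 'cV_q) (y : 'cV_n), T ^+ s.-1 *m (U *m a) = T ^+ s *m y -> a = 0].

(** A short exact sequence 0 -> X -> P -> Y -> 0 with P free.  Lift generators u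
    of the non-free part of Y to e in P; then the generators u' of the non-free
    part of X are given by T^s e.  Each condition for Y follows by lifting to P,
    applying one for X and dividing by a power of T, and conversely. *)
Section Heller.
Variables (s a b c q : nat).
Variables (X : 'M[K]_a) (P : 'M[K]_b) (Y : 'M[K]_c).
Variables (f : 'M[K]_(b, a)) (g : 'M[K]_(c, b)).
Variables (e : 'M[K]_(b, q)) (u : 'M[K]_(c, q)) (u' : 'M[K]_(a, q)).
Hypotheses (fX : f *m X = P *m f) (gP : g *m P = Y *m g).
Hypotheses (fg : exact_pair f g) (freeP : free_op P) (s_p : (0 < s < p)%N).
Hypotheses (fu' : f *m u' = P ^+ s *m e) (ge : g *m e = u).

Let subKs : (p - (p - s) = s)%N. Proof. lia. Qed.

Let kerP i j (v w : 'cV_b) : (i + j = p)%N -> (0 < i)%N ->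
  P ^+ i *m v = P ^+ i *m w -> exists y, v = P ^+ j *m y + w.
Proof.
move=> ij i_gt0 Pvw; have ->: j = (p - i)%N by lia.
have [||y Dy] := @free_ker _ P i (v - w) freeP; first by lia.
  by rewrite mulmxBr Pvw subrr.
by exists y; rewrite -Dy subrK.
Qed.

Let ker_g (v w : 'cV_b) : g *m v = g *m w -> exists z, v = f *m z + w.
Proof.
have [_ _ exact_fg] := fg; move=> gvw.
have /exact_fg[z Dz] : g *m (v - w) = 0 by rewrite mulmxBr gvw subrr.
by exists z; rewrite -Dz subrK.
Qed.

Let gf r (v : 'M_(a, r)) : g *m (f *m v) = 0.
Proof.
have /exact_split[_ [_ [_ _ gf0 _]]] := fg.
by rewrite mulmxA gf0 mul0mx.
Qed.

Let P0 i r (v : 'M_(b, r)) : (p <= i)%N -> P ^+ i *m v = 0.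
Proof. by apply: mul_expmx_ge; case: freeP. Qed.

Let Pf i r (v : 'M_(a, r)) : P ^+ i *m (f *m v) = f *m (X ^+ i *m v).
Proof. by rewrite (intertwineXv _ _ fX). Qed.

Let Yg i r (v : 'M_(b, r)) : Y ^+ i *m (g *m v) = g *m (P ^+ i *m v).
Proof. by rewrite (intertwineXv _ _ gP). Qed.

Let fu'v r (v : 'M_(q, r)) : f *m (u' *m v) = P ^+ s *m (e *m v).
Proof. by rewrite mulmxA fu' mulmxA. Qed.

Let uv r (v : 'M_(q, r)) : u *m v = g *m (e *m v).
Proof. by rewrite -ge mulmxA. Qed.

Lemma stable_blocks_quotient : stable_blocks (p - s) X u' -> stable_blocks s Y u.
Proof.
have [inj_f surj_g exact_fg] := fg.
case; rewrite subKs => _ ker1 ker2 indep; split.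
- by rewrite -[u]mulmx1 uv Yg -fu'v gf.
- move=> v; have [V <-] := surj_g v; rewrite Yg => /exact_fg[w Dw].
  have [|z [t Dt]] := ker1 w.
    apply: (inj_mx_cancel inj_f).
    by rewrite mulmx0 -Pf -Dw mul_expmxD P0 //; lia.
  have [|||y ->] := @kerP s (p - s)%N V (f *m z + e *m t); try lia.
    by rewrite Dw Dt !mulmxDr Pf fu'v.
  by exists (g *m y), t; rewrite !mulmxDr gf add0r Yg uv.
- move=> v; have [V <-] := surj_g v; rewrite Yg => /exact_fg[w Dw].
  have [|z [t Dt]] := ker2 w.
    apply: (inj_mx_cancel inj_f).
    by rewrite mulmx0 -Pf -Dw mul_expmxD P0 //; lia.
  have [|||y ->] := @kerP (p - s)%N s V (f *m z + P ^+ s.-1 *m (e *m t)); try lia.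
    rewrite Dw Dt !mulmxDr -!Pf fu'v !mul_expmxD; congr (_ + _ *m _).
    by congr (P ^+ _); lia.
  by exists (g *m y), t; rewrite !mulmxDr gf add0r uv !Yg.
move=> t y; have [Z <-] := surj_g y; rewrite uv !Yg => /ker_g[z Dz].
apply: (indep _ z); apply: (inj_mx_cancel inj_f).
have := congr1 (mulmx (P ^+ (p - s))) Dz.
rewrite mulmxDr !mul_expmxD [X in _ + X]P0 ?addr0; last lia.
rewrite -!Pf fu'v mul_expmxD => <-; congr (P ^+ _ *m _); lia.
Qed.

Lemma stable_blocks_syzygy : stable_blocks s Y u -> stable_blocks (p - s) X u'.
Proof.
have [inj_f surj_g exact_fg] := fg.
case=> _ ker1 ker2 indep; split; rewrite ?subKs.
- apply: (inj_mx_cancel inj_f); rewrite -Pf fu' mul_expmxD mulmx0 P0 //; lia.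
- move=> v Xv; have [|||y] := @kerP (p - s)%N s (f *m v) 0; try lia.
    by rewrite Pf Xv !mulmx0.
  rewrite addr0 => Dy.
  have [|z [t]] := ker1 (g *m y); first by rewrite Yg -Dy -[v]mulmx1 gf.
  have [Z <-] := surj_g z; rewrite uv Yg -mulmxDr => /ker_g[x Dx].
  exists x, t; apply: (inj_mx_cancel inj_f).
  rewrite Dy Dx !mulmxDr mul_expmxD [X in _ + (X + _)]P0 ?add0r; last lia.
  by rewrite Pf fu'v.
- move=> v Xv; have [|||y] := @kerP s (p - s)%N (f *m v) 0; try lia.
    by rewrite Pf Xv !mulmx0.
  rewrite addr0 => Dy.
  have [|z [t]] := ker2 (g *m y); first by rewrite Yg -Dy -[v]mulmx1 gf.
  have [Z <-] := surj_g z; rewrite uv !Yg -mulmxDr => /ker_g[x Dx].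
  exists x, t; apply: (inj_mx_cancel inj_f).
  rewrite Dy Dx !mulmxDr !mul_expmxD [X in _ + (X + _)]P0 ?add0r; last lia.
  by rewrite -!Pf fu'v mul_expmxD; congr (_ + P ^+ _ *m _); lia.
move=> t y Dy.
have [|||z Dz] := @kerP (p - s)%N s (P ^+ s.-1 *m (e *m t)) (f *m y); try lia.
  rewrite Pf -Dy -Pf fu'v !mul_expmxD; congr (P ^+ _ *m _); lia.
apply: (indep t (g *m z)); rewrite uv !Yg Dz mulmxDr gf addr0 //.
Qed.

End Heller.
End Blocks.

Lemma mulmx_sum_col (F : fieldType) a b (A : 'M[F]_(a, b)) (v : 'cV_b) :
  A *m v = \sum_j v j 0 *: col j A.
Proof.
apply/colP => i; rewrite !mxE summxE; apply: eq_bigr => j _.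
by rewrite !mxE mulrC.
Qed.

(** * Direct sums and retracts *)

(** The sum is given by injections and projections rather than by a block
    matrix, so that it can be transported along the isomorphisms of modules.
    A further free summand Q is allowed. *)
Section DirectSum.
Variables (K : fieldType) (p s m n e : nat) (d : 'I_m -> nat).
Variables (T : 'M[K]_n) (T_ : forall j, 'M[K]_(d j)) (TQ : 'M[K]_e).
Variables (u : forall j, 'cV[K]_(d j)).
Variables (inj : forall j, 'M[K]_(n, d j)) (proj : forall j, 'M[K]_(d j, n)).
Variables (injQ : 'M[K]_(n, e)) (projQ : 'M[K]_(e, n)).
Hypotheses (injT : forall j, inj j *m T_ j = T *m inj j).
Hypotheses (projT : forall j, proj j *m T = T_ j *m proj j).
Hypotheses (injQT : injQ *m TQ = T *m injQ).
Hypotheses (projQT : projQ *m T = TQ *m projQ).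
Hypotheses (injK : forall j, proj j *m inj j = 1%:M).
Hypotheses (inj_ortho : forall i j, i != j -> proj i *m inj j = 0).
Hypotheses (inj_proj : \sum_j inj j *m proj j + injQ *m projQ = 1%:M).
Hypotheses (s_p : (0 < s < p)%N) (freeQ : free_op p TQ).

Let U : 'M[K]_(n, m) := \matrix_(i, j) (inj j *m u j) i 0.

Let UE (a : 'cV_m) : U *m a = \sum_j inj j *m (u j *m (a j 0)%:M).
Proof.
rewrite mulmx_sum_col; apply: eq_bigr => j _.
rewrite mul_mx_scalar -scalemxAr; congr (_ *: _).
by apply/colP => i; rewrite !mxE.
Qed.

Let decomp q (v : 'M_(n, q)) :
  v = \sum_j inj j *m (proj j *m v) + injQ *m (projQ *m v).
Proof.
rewrite -[LHS]mul1mx -inj_proj mulmxDl mulmx_suml mulmxA; congr (_ + _).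
by apply: eq_bigr => j _; rewrite mulmxA.
Qed.

Let glue i i' (v : 'cV_n) :
  (forall j, exists y a, proj j *m v = T_ j ^+ i *m y + T_ j ^+ i' *m (u j *m a)) ->
  (exists y, projQ *m v = TQ ^+ i *m y) ->
  exists y a, v = T ^+ i *m y + T ^+ i' *m (U *m a).
Proof.
move=> /fin_all_exists[y /fin_all_exists[a Dv]] [yQ DvQ].
exists (\sum_j inj j *m y j + injQ *m yQ), (\col_j a j 0 0).
rewrite [LHS]decomp DvQ (intertwineXv _ _ injQT) mulmxDr addrAC; congr (_ + _).
rewrite UE !mulmx_sumr -big_split; apply: eq_bigr => j _ /=.
rewrite Dv mulmxDr !(intertwineXv _ _ (injT j)) mxE; congr (_ + _ *m (_ *m (_ *m _))).
exact: mx11_scalar.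
Qed.

Lemma stable_blocks_direct_sum :
  (forall j, stable_blocks p s (T_ j) (u j)) -> stable_blocks p s T U.
Proof.
move=> blk; split.
- suff TsU (a : 'cV_m) : T ^+ s *m (U *m a) = 0.
    apply/matrixP => i j; have /matrixP/(_ i 0) := TsU (delta_mx j 0).
    by rewrite mulmxA -colE !mxE.
  rewrite UE mulmx_sumr big1 // => j _; rewrite -(intertwineXv _ _ (injT j)).
  by have [Tu _ _ _] := blk j; rewrite [X in _ *m X]mulmxA Tu mul0mx mulmx0.
- move=> v Tsv; have [j||y [a ->]] := @glue (p - s)%N 0%N v.
  + have [_ ker1 _ _] := blk j.
    have [|y [a Dv]] := ker1 (proj j *m v).
      by rewrite -(intertwineXv _ _ (projT j)) Tsv mulmx0.
    by exists y, a; rewrite expr0 mul1mx.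
  + apply: free_ker => //; first by lia.
    by rewrite -(intertwineXv _ _ projQT) Tsv mulmx0.
  by exists y, a; rewrite expr0 mul1mx.
- move=> v Tsv; apply: glue => [j|].
  + have [_ _ ker2 _] := blk j; apply: ker2.
    by rewrite -(intertwineXv _ _ (projT j)) Tsv mulmx0.
  + have ->: s = (p - (p - s))%N by lia.
    apply: free_ker => //; first by lia.
    by rewrite -(intertwineXv _ _ projQT) Tsv mulmx0.
move=> a y Dy; apply/colP => j; rewrite mxE.
have [_ _ _ indep] := blk j.
suff /indep/matrixP/(_ 0 0) :
    T_ j ^+ s.-1 *m (u j *m (a j 0)%:M) = T_ j ^+ s *m (proj j *m y).
  by rewrite !mxE eqxx.
rewrite -(intertwineXv _ _ (projT j)) -Dy (intertwineXv _ _ (projT j)).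
congr (_ *m _); rewrite UE mulmx_sumr (bigD1 j) //= mulmxA injK mul1mx.
rewrite big1 ?addr0 // => i ij; rewrite mulmxA inj_ortho 1?eq_sym //.
by rewrite mul0mx.
Qed.

End DirectSum.

Lemma free_op_retract (K : fieldType) p n e (T : 'M[K]_n) (S : 'M[K]_e)
    (i : 'M_(e, n)) (r : 'M_(n, e)) :
  i *m T = S *m i -> r *m S = T *m r -> r *m i = 1%:M ->
  free_op p S -> free_op p T.
Proof.
move=> iT rS ri [Sp0 kerS]; split=> [|v Tv].
  by rewrite -[LHS]mul1mx -ri -mulmxA (intertwineX _ iT) Sp0 mul0mx mulmx0.
have [|y Dy] := kerS (i *m v); first by rewrite -(intertwineXv _ _ iT) Tv mulmx0.
by exists (r *m y); rewrite -[v]mul1mx -ri -mulmxA Dy !mulmxA rS.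
Qed.

Lemma free_op_direct_sum (K : fieldType) p m n (d : 'I_m -> nat) (T : 'M[K]_n)
    (T_ : forall j, 'M[K]_(d j)) (inj : forall j, 'M[K]_(n, d j))
    (proj : forall j, 'M[K]_(d j, n)) :
  (forall j, inj j *m T_ j = T *m inj j) ->
  (forall j, proj j *m T = T_ j *m proj j) ->
  \sum_j inj j *m proj j = 1%:M ->
  (forall j, free_op p (T_ j)) -> free_op p T.
Proof.
move=> injT projT inj_proj freeT; split=> [|v Tv].
  rewrite -[LHS]mulmx1 -inj_proj mulmx_sumr big1 // => j _.
  by rewrite mulmxA -(intertwineX _ (injT j)) (freeT j).1 mulmx0 mul0mx.
have /fin_all_exists[y Dy] : forall j, exists y, proj j *m v = T_ j *m y.
  by move=> j; apply: (freeT j).2; rewrite -(intertwineXv _ _ (projT j)) Tv mulmx0.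
exists (\sum_j inj j *m y j).
rewrite -[LHS]mul1mx -inj_proj mulmx_suml mulmx_sumr; apply: eq_bigr => j _.
by rewrite -mulmxA Dy mulmxA injT mulmxA.
Qed.

(** * Jordan type from generators *)

Section Generators.
Variables (K : fieldType) (p d : nat) (T : 'M[K]_d).
Hypothesis Tp0 : T ^+ p = 0.

Section Chains.
Variables (s : seq nat) (X : 'I_(size s) -> 'cV[K]_d).
Local Notation ht l := (nth 0%N s l).
Local Notation J := (\mxdiag_(l < size s) jblock K (nth 0%N s l)).
Hypothesis ht_gt0 : forall l : 'I_(size s), (0 < ht l)%N.
Hypothesis ht_le : forall l : 'I_(size s), (ht l <= p)%N.
Hypothesis XT : forall l : 'I_(size s), T ^+ (ht l) *m X l = 0.
Hypothesis indep : forall a : 'I_(size s) -> K,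
  \sum_l a l *: (T ^+ (ht l).-1 *m X l) = 0 -> forall l, a l = 0.
Hypothesis gen : forall v : 'cV_d, exists (a : 'I_(size s) -> K) y,
  v = \sum_l a l *: X l + T *m y.

(* The map from the block [ht l] that sends 1 to X l. *)
Let chain (l : 'I_(size s)) : 'M[K]_(d, ht l) := \matrix_(i, j) (T ^+ j *m X l) i 0.

Let chainE (l : 'I_(size s)) (v : 'cV_(ht l)) :
  chain l *m v = \sum_j v j 0 *: (T ^+ j *m X l).
Proof.
rewrite mulmx_sum_col; apply: eq_bigr => j _; congr (_ *: _).
by apply/colP => i; rewrite !mxE.
Qed.

Let chainT (l : 'I_(size s)) : T *m chain l = chain l *m jblock K (ht l).
Proof.
apply/matrixP => i j.
transitivity ((T ^+ j.+1 *m X l) i 0).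
  rewrite exprS -mulmxE -mulmxA !mxE; apply: eq_bigr => r _.
  by rewrite !mxE.
rewrite [RHS]mxE; have [lt_j1|] := ltnP j.+1 (ht l).
  rewrite (bigD1 (Ordinal lt_j1)) //= [X in _ + X]big1 => [|r].
    by rewrite addr0 [chain _ _ _]mxE [jblock _ _ _ _]mxE eqxx mulr1.
  by rewrite [jblock _ _ _ _]mxE -val_eqE /= => /negPf->; rewrite mulr0.
move=> ge_j1; have Dj: j.+1 = ht l by apply/eqP; rewrite eqn_leq ltn_ord.
rewrite Dj XT mxE big1 // => r _; rewrite !mxE Dj [_ == _]negbTE ?mulr0 //.
by rewrite neq_ltn ltn_ord.
Qed.

Let h : 'M[K]_(d, \sum_(l < size s) ht l) := \mxrow_l chain l.

Let hT : T *m h = h *m J.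
Proof.
rewrite mul_mxrow mul_mxrow_mxdiag; apply: eq_mxrow => l; exact: chainT.
Qed.

(* The kernel relation is killed one coefficient layer at a time: applying
   T^M leaves only the terms that T^M carries into the socles. *)
Let h_inj : inj_mx h.
Proof.
move=> w hw0.
pose W (l : 'I_(size s)) : 'cV_(ht l) := submxcol w l.
suff W0 : forall (l : 'I_(size s)) j, W l j 0 = 0.
  rewrite -[w]submxcolK -[RHS](@mxcol0 _ _ (fun l : 'I_(size s) => ht l)).
  apply: eq_mxcol => l.
  by apply/colP => j; rewrite [LHS]W0 mxE.
have {}hw0 : \sum_l \sum_j W l j 0 *: (T ^+ j *m X l) = 0.
  transitivity (h *m w) => //; rewrite -[w]submxcolK mul_mxrow_mxcol.
  by apply: eq_bigr => l _; rewrite chainE.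
suff Z N :
    forall (l : 'I_(size s)) (j : 'I_(ht l)), (j + (p - N) < ht l)%N -> W l j 0 = 0.
  move=> l j; apply: (Z p); by rewrite subnn addn0.
elim: N => [|N IHN] l j; rewrite ?subn0 => lt_j.
  by have := ht_le l; lia.
have [le_pN|lt_Np] := leqP p N.
  apply: IHN; apply: leq_trans lt_j; lia.
set M := (p - N.+1)%N in lt_j *.
have DM : (p - N = M.+1)%N by rewrite /M; lia.
rewrite DM in IHN.
have [|le_j] := ltnP (j + M.+1) (ht l); first exact: IHN.
have lt_M i : (0 < i)%N -> (i - M.+1 < i)%N by lia.
(* ht i - (M + 1) is the position that T^M moves to the socle of chain i; the
   default 0 covers the chains that T^M kills. *)
pose a (i : 'I_(size s)) :=
  if (M < ht i)%N then W i (Ordinal (lt_M _ (ht_gt0 i))) 0 else 0.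
have /indep/(_ l): \sum_i a i *: (T ^+ (ht i).-1 *m X i) = 0.
  have := congr1 (mulmx (T ^+ M)) hw0; rewrite mulmx0 mulmx_sumr => hw1.
  rewrite -[RHS]hw1; apply: eq_bigr => i _; rewrite /a mulmx_sumr.
  have zero (r : 'I_(ht i)) : (ht i <= r + M)%N ->
     T ^+ M *m (W i r 0 *: (T ^+ r *m X i)) = 0.
    move=> le_r; rewrite -scalemxAr mul_expmxD addnC -(subnK le_r).
    by rewrite -mul_expmxD XT mulmx0 scaler0.
  have [lt_Mi|le_iM] := ltnP M (ht i); last first.
    by rewrite scale0r big1 // => r _; apply: zero; lia.
  rewrite [RHS](bigD1 (Ordinal (lt_M _ (ht_gt0 i)))) //= big1 => [|r ne_r].
    by rewrite addr0 -[RHS]scalemxAr mul_expmxD; congr (_ *: (_ ^+ _ *m _)) => /=; lia.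
  have [le_r|lt_r] := leqP (ht i) (r + M); first exact: zero.
  rewrite IHN ?scale0r ?mulmx0 //; move: ne_r; rewrite -val_eqE /=; lia.
rewrite /a ifT; last by lia.
by move=> <-; congr (W l _ 0); apply: val_inj => /=; lia.
Qed.

(* Generators modulo T V generate V, as T is nilpotent. *)
Let h_surj : surj_mx h.
Proof.
move=> v.
suff gen_mod N : exists w y, v = h *m w + T ^+ N *m y.
  have [w [y Dv]] := gen_mod p; exists w; by rewrite Dv Tp0 mul0mx addr0.
have hX (l : 'I_(size s)) : exists w, h *m w = X l.
  exists (\mxcol_i (if i == l then \col_(j < ht i) (j == 0 :> nat)%:R else 0)).
  rewrite mul_mxrow_mxcol (bigD1 l) //= eqxx big1 ?addr0; last first.
    by move=> i /negPf ->; rewrite mulmx0.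
  rewrite chainE (bigD1 (Ordinal (ht_gt0 l))) //= big1 ?addr0; last first.
    by move=> j; rewrite -val_eqE mxE /= => /negPf->; rewrite scale0r.
  by rewrite mxE eqxx scale1r expr0 mul1mx.
have [E hE] := fin_all_exists hX.
elim: N => [|N [w [y ->]]]; first by exists 0, v; rewrite mulmx0 add0r expr0 mul1mx.
have [a [y' ->]] := gen y.
exists (w + J ^+ N *m (\sum_l a l *: E l)), y'.
rewrite mulmxDr -addrA; congr (_ + _); rewrite mulmxDr mul_expmxSr; congr (_ + _).
rewrite (intertwineXv _ _ (esym hT)); congr (_ *m _); rewrite mulmx_sumr.
by apply: eq_bigr => l _; rewrite -scalemxAr hE.
Qed.

(** Independence of the socles makes the sum of the cyclic modules generated by
    the X l inject into V, generation modulo T makes it surjective. *)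
Lemma chains_basis : exists g h,
  inverse_mx g h /\ g *m T = J *m (g : 'M_(\sum_(l < size s) ht l, d)).
Proof.
have [g hg] : exists g, h *m g = 1%:M by apply: matrix_of_columns.
have gh : g *m h = 1%:M.
  by apply: (inj_mx_cancel h_inj); rewrite mulmxA hg mul1mx mulmx1.
exists g, h; split=> //.
by rewrite -[T]mulmx1 -hg [T *m _]mulmxA hT !mulmxA gh mul1mx.
Qed.
End Chains.
End Generators.

(** The same criterion with generators indexed by a finite type, which lets them
    come in groups of different heights. *)
Lemma jordan_type_of_chains (K : fieldType) p d (T : 'M[K]_d) (I : finType)
    (ht : I -> nat) (X : I -> 'cV[K]_d) :
  T ^+ p = 0 -> (forall x, 0 < ht x <= p)%N ->
  (forall x, T ^+ ht x *m X x = 0) ->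
  (forall a : I -> K, \sum_x a x *: (T ^+ (ht x).-1 *m X x) = 0 ->
     forall x, a x = 0) ->
  (forall v : 'cV_d, exists (a : I -> K) y, v = \sum_x a x *: X x + T *m y) ->
  (\sum_x ht x)%N = d /\ jordan_type p T (fun i => \sum_x (ht x == i))%N.
Proof.
move=> Tp0 ht_p XT indep gen.
pose s := [seq ht x | x <- enum I].
have Es : size s = #|I| by rewrite size_map cardE.
pose phi (l : 'I_(size s)) : I := enum_val (cast_ord Es l).
pose psi (x : I) : 'I_(size s) := cast_ord (esym Es) (enum_rank x).
have phiK : cancel phi psi by move=> l; rewrite /psi enum_valK cast_ordK.
have psiK : cancel psi phi by move=> x; rewrite /phi cast_ordKV enum_rankK.
have nth_s (l : 'I_(size s)) : nth 0%N s l = ht (phi l).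
  have lt_l : (l < size (enum I))%N by rewrite -cardE -Es.
  have x0 : I := phi l.
  by rewrite (nth_map x0) // /phi (enum_val_nth x0).
have sumE (V : nmodType) (f : I -> V) : \sum_x f x = \sum_l f (phi l).
  by apply: reindex; exists psi => ? _.
have [||l|a|v|g [h [gh gT]]] := @chains_basis K p d T Tp0 s (X \o phi).
- by move=> l; rewrite nth_s; have /andP[] := ht_p (phi l).
- by move=> l; rewrite nth_s; have /andP[] := ht_p (phi l).
- by rewrite nth_s XT.
- move=> a0 l; rewrite -[l]phiK; apply: (indep (a \o psi)).
  rewrite sumE -[RHS]a0; apply: eq_bigr => j _.
  by rewrite /= phiK nth_s.
- have [a [y ->]] := gen v; exists (a \o phi), y.
  by rewrite sumE.
split.
  have -> : (\sum_x ht x)%N = (\sum_(l < size s) nth 0%N s l)%N.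
    rewrite -(big_mkord xpredT (nth 0%N s)) -(big_nth _ xpredT id) big_map.
    by rewrite big_enum.
  by apply/eqP; rewrite eqn_leq !(mulmx1_min gh.1, mulmx1_min gh.2).
exists s; split; last by exists g, h.
- by apply/allP => _ /mapP[x _ ->].
- move=> i _; rewrite count_map -sumn_count sumnE big_map big_enum.
  by apply: eq_bigr => x _ /=.
Qed.

(** * The kernel of a map from [p-1]^m + free onto [1]^n + free *)

Section Kernel.
Variables (K : fieldType) (p a b c m n : nat).
Variables (L : 'M[K]_a) (M : 'M[K]_b) (N : 'M[K]_c).
Variables (i : 'M[K]_(b, a)) (phi : 'M[K]_(c, b)).
Variables (U : 'M[K]_(b, m)) (W : 'M[K]_(c, n)) (C : 'M[K]_(n, m)).
Variable (Y : 'M[K]_(c, m)).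
Hypotheses (p_gt2 : (2 < p)%N).
Hypotheses (iL : i *m L = M *m i) (phiM : phi *m M = N *m phi).
Hypotheses (exact_iphi : exact_pair i phi) (Mp0 : M ^+ p = 0).
Hypotheses (blkM : stable_blocks p p.-1 M U) (blkN : stable_blocks p 1 N W).
Hypotheses (phiU : phi *m U = W *m C + N *m Y) (rankC : \rank C = n).

(* The image of N is the image under phi of the image of M, so the error term
   N Y can be absorbed in U; changing U by columns in the image of M preserves
   the block structure because M^p = 0. *)
Let lift_generators : exists U' : 'M_(b, m),
  phi *m U' = W *m C /\ stable_blocks p p.-1 M U'.
Proof.
have /exact_split[_ [s [_ phis _ _]]] := exact_iphi.
exists (U - M *m (s *m Y)); split.
  by rewrite mulmxBr [phi *m (M *m _)]mulmxA phiM -[N *m phi *m _]mulmxA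
    [phi *m (s *m _)]mulmxA phis mul1mx phiU addrK.
have pE : (p - p.-1 = 1)%N by lia.
have pE' : p.-1 = p.-1.-1.+1 by lia.
have [MU ker1 ker2 indep] := blkM; rewrite pE in ker1 ker2.
split; rewrite ?pE.
- by rewrite mulmxBr MU mul_expmxSr (mul_expmx_ge _ Mp0) ?subr0 //; lia.
- move=> v /ker1[y [t ->]]; exists (y + s *m Y *m t), t.
  rewrite expr1 mulmxDr mulmxBl -!mulmxA -addrA.
  by rewrite [X in _ = _ + X]addrC subrK.
- move=> v /ker2[y [t ->]]; exists (y + s *m Y *m t), t.
  rewrite mulmxDr -addrA; congr (_ + _); rewrite mulmxBl mulmxBr.
  by rewrite -!mulmxA mul_expmxSr -pE' addrC subrK.
move=> t y Dy; apply: (indep t (y + s *m Y *m t)).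
by rewrite mulmxDr -Dy mulmxBl mulmxBr -!mulmxA mul_expmxSr -pE' subrK.
Qed.

(** With C B = 1 and D a basis of ker C, the generators are those Fm of the
    free part, U' D of height p-1, and M U' B of height p-2; the number of free
    blocks is what the dimension of L leaves. *)
Lemma jordan_type_kernel : jordan_type p L (fun s =>
  if s == p.-1 then (m - n)%N else if s == p.-2 then n else
  ((a - ((m - n) * p.-1 + n * p.-2)) %/ p * (s == p))%N).
Proof.
have [U' [phiU' [MU' ker1 ker2 indep]]] := lift_generators.
have [NW kerN _ indepN] := blkN.
have [inj_i surj_phi exact_ip] := exact_iphi.
have /exact_split[r [s [_ phis _ irs]]] := exact_iphi.
have lift_i q (V : 'M_(b, q)) : phi *m V = 0 -> i *m (r *m V) = V.
  by move=> V0; rewrite -[RHS]mul1mx -irs mulmxDl -!mulmxA V0 mulmx0 addr0.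
have pE : (p - p.-1 = 1)%N by lia.
have Lp0 : L ^+ p = 0.
  by apply: (inj_mx_cancel inj_i); rewrite (intertwineX _ iL) Mp0 mul0mx mulmx0.
have iLv j q (v : 'M_(a, q)) : i *m (L ^+ j *m v) = M ^+ j *m (i *m v).
  exact: intertwineXv.
have freeC : row_free C by rewrite /row_free rankC.
have [B CB] : exists B, C *m B = 1%:M by exists (pinvmx C); apply: mulmxVp.
pose q := \rank (kermx C^T); pose D : 'M_(m, q) := (row_base (kermx C^T))^T.
have Dq : q = (m - n)%N by rewrite /q mxrank_ker mxrank_tr rankC.
have CD : C *m D = 0.
  by apply: trmx_inj; rewrite trmx_mul trmxK trmx0; apply/sub_kermxP; rewrite eq_row_base.
have kerC (t : 'cV_m) : C *m t = 0 -> exists z, t = D *m z.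
  move=> Ct; have: (t^T <= row_base (kermx C^T))%MS.
    by rewrite eq_row_base; apply/sub_kermxP; rewrite -trmx_mul Ct trmx0.
  case/submxP => z Dz; exists z^T; apply: trmx_inj.
  by rewrite Dz trmx_mul !trmxK.
have injD (z : 'cV_q) : D *m z = 0 -> z = 0.
  move=> Dz; apply: trmx_inj; rewrite trmx0.
  apply: (row_free_inj (row_base_free (kermx C^T))).
  by rewrite mul0mx -[row_base _]trmxK -trmx_mul Dz trmx0.
(* Fm lifts a basis of the image of L^(p-1), that is, of the socle of the free
   part of L. *)
pose A := L ^+ p.-1; pose Fm := pinvmx (row_base A).
have AF : A *m Fm = col_base A.
  have := congr1 (mulmx^~ Fm) (mulmx_base A).
  by rewrite /= -mulmxA mulmxVp ?row_base_free // mulmx1.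
have injAF (z : 'cV_(\rank A)) : A *m (Fm *m z) = 0 -> z = 0.
  rewrite mulmxA AF => Dz; rewrite -[z]mul1mx -(mulVpmx (col_base_full A)).
  by rewrite -mulmxA Dz mulmx0.
pose E := r *m (U' *m D); have iE : i *m E = U' *m D.
  by apply: lift_i; rewrite mulmxA phiU' -mulmxA CD mulmx0.
pose E' := r *m (M *m (U' *m B)); have iE' : i *m E' = M *m (U' *m B).
  apply: lift_i; rewrite mulmxA phiM -mulmxA [phi *m (U' *m _)]mulmxA phiU' -mulmxA CB.
  by rewrite mulmx1 -[N]expr1.
have iEv e (z : 'M_(q, e)) : i *m (E *m z) = U' *m (D *m z).
  by rewrite mulmxA iE -mulmxA.
have iE'v e (z : 'M_(n, e)) : i *m (E' *m z) = M *m (U' *m (B *m z)).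
  by rewrite mulmxA iE' -!mulmxA.
pose I : finType := ('I_(\rank A) + ('I_q + 'I_n))%type.
pose ht (x : I) : nat := match x with
  | inl _ => p | inr (inl _) => p.-1 | inr (inr _) => p.-2 end.
pose X (x : I) : 'cV_a := match x with
  | inl j => col j Fm | inr (inl j) => col j E | inr (inr j) => col j E' end.
have sumI (V : nmodType) (f : I -> V) : \sum_x f x =
    \sum_j f (inl j) + (\sum_j f (inr (inl j)) + \sum_j f (inr (inr j))).
  by rewrite big_sumType; congr (_ + _); rewrite big_sumType.
have sumXE (f : I -> K) (g : nat -> 'M_a) :
    \sum_x f x *: (g (ht x) *m X x) =
    g p *m (Fm *m \col_j f (inl j)) + (g p.-1 *m (E *m \col_j f (inr (inl j)))
      + g p.-2 *m (E' *m \col_j f (inr (inr j)))).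
  rewrite sumI; congr (_ + (_ + _));
    rewrite [X in _ = _ *m X]mulmx_sum_col mulmx_sumr;
    by apply: eq_bigr => j _; rewrite mxE -scalemxAr.
have [||f|v|dimL jtL] := @jordan_type_of_chains K p a L I ht X Lp0.
- by case=> [_|[_|_]] /=; lia.
- case=> [j|[j|j]] /=.
  + by rewrite Lp0 mul0mx.
  + apply: (inj_mx_cancel inj_i); rewrite iLv colE [i *m _]mulmxA iE mulmx0.
    by rewrite !mulmxA MU' !mul0mx.
  + apply: (inj_mx_cancel inj_i); rewrite iLv colE [i *m _]mulmxA iE' mulmx0.
    rewrite -!mulmxA mul_expmxSr (_ : p.-2.+1 = p.-1); last lia.
    by rewrite !mulmxA MU' !mul0mx.
- rewrite (sumXE f (fun h => L ^+ h.-1)).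
  set af := \col_j _; set ae := \col_j _; set ab := \col_j _ => sum0.
  (* The socles of the chains of heights p-1 and p-2 are combinations of
     M^(p-2) U', whose columns are independent modulo the image of M^(p-1). *)
  have Dab : D *m ae + B *m ab = 0.
    apply: (indep _ (- (i *m (Fm *m af)))).
    have := congr1 (mulmx i) sum0; rewrite mulmx0 !mulmxDr !iLv iEv iE'v.
    rewrite mul_expmxSr (_ : p.-2.-1.+1 = p.-2); last lia.
    by move/(canRL (addKr _)); rewrite addr0 mulmxN => <-.
  have ab0 : ab = 0.
    have := congr1 (mulmx C) Dab.
    rewrite mulmx0 mulmxDr [C *m (D *m _)]mulmxA CD [C *m (B *m _)]mulmxA CB.
    by rewrite mul0mx mul1mx add0r.
  have ae0 : ae = 0 by apply: injD; rewrite -[RHS]Dab ab0 mulmx0 addr0.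
  have af0 : af = 0.
    by apply: injAF; rewrite -[RHS]sum0 ab0 ae0 !mulmx0 !addr0.
  case=> [j|[j|j]].
  + by have /colP/(_ j) := af0; rewrite !mxE.
  + by have /colP/(_ j) := ae0; rewrite !mxE.
  + by have /colP/(_ j) := ab0; rewrite !mxE.
- pose af := row_base A *m v.
  have Av : A *m v = A *m (Fm *m af).
    by rewrite [RHS]mulmxA AF mulmxA mulmx_base.
  (* After subtracting the free part, v is U' t modulo the image of M; it lies
     in the kernel of phi, so C t = 0. *)
  have [|y [t]] := ker1 (i *m (v - Fm *m af)).
    by rewrite -iLv mulmxBr Av subrr mulmx0.
  rewrite pE expr1 => Dv.
  have Ct : C *m t = 0.
    apply: (indepN _ (- (phi *m y))); rewrite expr0 mul1mx expr1.
    have : phi *m (i *m (v - Fm *m af)) = 0 by apply/exact_ip; exists (v - Fm *m af).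
    rewrite Dv mulmxDr !mulmxA phiM phiU' -!mulmxA mulmxN.
    by move/(canRL (addKr _)); rewrite addr0.
  have [z Dz] := kerC t Ct.
  (* What is left is M y; as N kills phi y, the vector y differs from an element
     of the kernel of phi by a value of M^(p-1) and a combination of U' B. *)
  have [|y1 [w]] := kerN (phi *m y).
    rewrite expr1 mulmxA -phiM -mulmxA.
    have : phi *m (i *m (v - Fm *m af - E *m z)) = 0 by apply/exact_ip; eexists.
    by rewrite mulmxBr Dv Dz iEv addrK.
  have [y2 <-] := surj_phi y1.
  rewrite -(intertwineXv _ _ phiM) -[W]mulmx1 -CB [W *m (C *m B)]mulmxA.
  rewrite -phiU' -!mulmxA -mulmxDr => Dy.
  have /exact_ip[l Dl] : phi *m (y - (M ^+ (p - 1) *m y2 + U' *m (B *m w))) = 0.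
    by rewrite mulmxBr Dy subrr.
  pose f (x : I) := match x with
    | inl j => af j 0 | inr (inl j) => z j 0 | inr (inr j) => w j 0 end.
  exists f, l.
  have := sumXE f (fun=> 1%:M); under eq_bigr do rewrite mul1mx.
  move=> ->; rewrite !mul1mx.
  have colE' h (x : 'cV_h) : \col_j x j 0 = x by apply/colP => j; rewrite mxE.
  rewrite /f !colE' -!addrA; apply/eqP; rewrite addrC -subr_eq; apply/eqP.
  apply: (inj_mx_cancel inj_i); rewrite Dv !mulmxDr [i *m (L *m _)]mulmxA iL.
  rewrite -[M *m i *m l]mulmxA -Dl Dz iEv iE'v.
  rewrite mulmxBr mulmxDr mul_expmxS (mul_expmx_ge _ Mp0) //; last lia.
  by rewrite add0r addrC; congr (_ + _); rewrite addrC subrK.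
have [s0 [s0p s0c gh]] := jtL; exists s0; split=> // j /s0c ->.
rewrite sumI /= !sum_nat_const !card_ord Dq.
have DL : (\rank A * p + ((m - n) * p.-1 + n * p.-2) = a)%N.
  by rewrite -[RHS]dimL sumI /= !sum_nat_const !card_ord Dq.
have -> : ((a - ((m - n) * p.-1 + n * p.-2)) %/ p = \rank A)%N.
  move: (\rank A) DL => rk DL; rewrite -DL addnK mulnK //; lia.
rewrite [p == j]eq_sym [p.-1 == j]eq_sym [p.-2 == j]eq_sym.
have [jp | _] := eqVneq j p; have [j1 | _] := eqVneq j p.-1;
  have [j2 | _] := eqVneq j p.-2; rewrite /= ?muln0 ?muln1; lia.
Qed.

End Kernel.

(** * Injections and projections of block sums *)

Section BlockInjections.
Variables (F : fieldType) (n : nat) (d : 'I_n -> nat).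

(* The (i, j) block of the identity matrix. *)
Let Id i j : 'M[F]_(d i, d j) := if i == j then conform_mx 0 (1%:M : 'M_(d i)) else 0.

Let Id_id i : Id i i = 1%:M.
Proof. by rewrite /Id eqxx conform_mx_id. Qed.

Let Id_neq i j : i != j -> Id i j = 0.
Proof. by rewrite /Id => /negPf->. Qed.

Let Id_comm i j (A : forall l, 'M[F]_(d l)) : A i *m Id i j = Id i j *m A j.
Proof.
have [e|ij] := eqVneq i j; last by rewrite Id_neq // mulmx0 mul0mx.
by case: j / e; rewrite Id_id mulmx1 mul1mx.
Qed.

Let sum_Id i q (E : forall l, 'M[F]_(d l, q)) : \sum_j Id i j *m E j = E i.
Proof.
rewrite (bigD1 i) //= Id_id mul1mx big1 ?addr0 // => l li.
by rewrite Id_neq 1?eq_sym // mul0mx.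
Qed.

Definition block_inj j : 'M[F]_(\sum_i d i, d j) := \mxcol_i Id i j.
Definition block_proj j : 'M[F]_(d j, \sum_i d i) := \mxrow_i Id j i.

Lemma block_proj_mxcol i q (E : forall l, 'M[F]_(d l, q)) :
  block_proj i *m \mxcol_l E l = E i.
Proof. by rewrite mul_mxrow_mxcol sum_Id. Qed.

Lemma mxrow_block_inj j q (E : forall l, 'M[F]_(q, d l)) :
  \mxrow_l E l *m block_inj j = E j.
Proof.
rewrite mul_mxrow_mxcol (bigD1 j) //= Id_id mulmx1 big1 ?addr0 // => l lj.
by rewrite Id_neq // mulmx0.
Qed.

Lemma block_injK j : block_proj j *m block_inj j = 1%:M.
Proof. by rewrite block_proj_mxcol Id_id. Qed.

Lemma block_inj_ortho i j : i != j -> block_proj i *m block_inj j = 0.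
Proof. by move=> ij; rewrite block_proj_mxcol Id_neq. Qed.

Lemma block_inj_proj : \sum_j block_inj j *m block_proj j = 1%:M.
Proof.
transitivity (\sum_j \mxblock_(i, l) (Id i j *m Id j l)).
  by apply: eq_bigr => j _; apply: mul_mxcol_mxrow.
rewrite -mxblock_sum -(@mxdiagZ _ _ d); apply: eq_mxblock => i j.
rewrite (sum_Id i (fun l => Id l j)); case: eqVneq => [e|/Id_neq//].
by case: j / e; rewrite Id_id conform_mx_id.
Qed.

Lemma mxdiag_block_inj (A : forall i, 'M[F]_(d i)) j :
  block_inj j *m A j = \mxdiag_i A i *m block_inj j.
Proof.
rewrite mul_mxdiag_mxcol mxcol_mul; apply: eq_mxcol => i.
by rewrite Id_comm.
Qed.

Lemma mxdiag_block_proj (A : forall i, 'M[F]_(d i)) j :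
  block_proj j *m \mxdiag_i A i = A j *m block_proj j.
Proof.
rewrite mul_mxrow_mxdiag mul_mxrow; apply: eq_mxrow => i.
by rewrite Id_comm.
Qed.

End BlockInjections.

Lemma mxblock_block_inj (F : fieldType) m n (d : 'I_m -> nat) (e : 'I_n -> nat)
    (E : forall i j, 'M[F]_(e i, d j)) j :
  (\mxblock_(i < n, j < m) E i j) *m block_inj F d j =
  \sum_i block_inj F e i *m E i j.
Proof.
rewrite mxblockEh mxrow_block_inj -[LHS]mul1mx -block_inj_proj mulmx_suml.
by apply: eq_bigr => i _; rewrite -mulmxA block_proj_mxcol.
Qed.

(** * Modules over the group algebra *)

Section GroupAlgebraAction.
Variables (F : fieldType) (G : fgscheme F).
Implicit Types M N P : gmod G.

Lemma kgactM M (x y : 'rV_(gdim G)) :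
  kgact M (kgmul x y) = kgact M x *m kgact M y.
Proof.
rewrite /kgact mulmx_suml; under eq_bigr do rewrite mxE scaler_suml.
rewrite exchange_big; apply: eq_bigr => i _ /=; rewrite mulmx_sumr.
under eq_bigr do rewrite scaler_suml.
rewrite exchange_big; apply: eq_bigr => j _ /=.
rewrite -scalemxAl -scalemxAr mactM !scaler_sumr; apply: eq_bigr => l _.
by rewrite !scalerA.
Qed.

Lemma kgactX M (x : 'rV_(gdim G)) i : kgact M (kgexp x i) = kgact M x ^+ i.
Proof.
elim: i => [|i IHi]; last by rewrite /= kgactM IHi exprS.
by rewrite expr0 -[RHS]mact1; apply: eq_bigr => l _; rewrite mxE.
Qed.

Lemma kgact_nilp M (x : 'rV_(gdim G)) i : kgexp x i = 0 -> kgact M x ^+ i = 0.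
Proof.
move=> x0; rewrite -kgactX x0 /kgact big1 // => l _.
by rewrite mxE scale0r.
Qed.

Lemma ghom_kgact M N (f : 'M_(mdim N, mdim M)) (x : 'rV_(gdim G)) :
  ghom f -> f *m kgact M x = kgact N x *m f.
Proof.
move=> fG; rewrite mulmx_sumr mulmx_suml; apply: eq_bigr => i _.
by rewrite -scalemxAr -scalemxAl fG.
Qed.

Lemma ghom_inverse M N (f : 'M_(mdim N, mdim M)) g :
  @ghom F G M N f -> inverse_mx f g -> @ghom F G N M g.
Proof.
move=> fG [fg gf] i.
rewrite -[LHS]mulmx1 -fg mulmxA -[g *m mact N i *m f]mulmxA -fG.
by rewrite !mulmxA gf mul1mx.
Qed.

Lemma ghom_mul M N P (f : 'M_(mdim N, mdim M)) (g : 'M_(mdim P, mdim N)) :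
  ghom f -> ghom g -> @ghom F G M P (g *m f).
Proof. by move=> fG gG i; rewrite -mulmxA fG !mulmxA gG. Qed.

(** The homomorphism x |-> x e_j from the group algebra. *)
Definition orbit_map P (j : 'I_(mdim P)) : 'M[F]_(mdim P, mdim (regular_mod G)) :=
  \matrix_(r, l) mact P l r j.

(** A module is a quotient of a sum of copies of the group algebra, one for each
    basis vector; if it is projective the quotient map splits. *)
Lemma projective_retract P : projective P ->
  exists (i : 'M_(mdim (big_dsum (fun _ : 'I_(mdim P) => regular_mod G)), mdim P))
         (r : 'M_(mdim P, mdim (big_dsum (fun _ : 'I_(mdim P) => regular_mod G)))),
    [/\ ghom i, ghom r & r *m i = 1%:M].
Proof.
move=> projP; pose r := \mxrow_j @orbit_map P j.
have rG : @ghom F G (big_dsum (fun _ : 'I_(mdim P) => regular_mod G)) P r.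
  move=> i; rewrite mul_mxrow_mxdiag mul_mxrow; apply: eq_mxrow => j.
  apply/matrixP => a s; rewrite !mxE.
  transitivity ((mact P i *m mact P s) a j); last first.
    by rewrite mxE; apply: eq_bigr => b _; rewrite mxE.
  rewrite mactM summxE; apply: eq_bigr => l _.
  by rewrite !mxE mulrC.
have surj_r : surj_mx r.
  move=> v; exists (\mxcol_j (v j 0 *: \col_l gcou l)).
  rewrite mul_mxrow_mxcol -[RHS]mul1mx mulmx_sum_col; apply: eq_bigr => j _.
  rewrite -scalemxAr -(mact1 P); congr (_ *: _); apply/colP => a.
  by rewrite !mxE summxE; apply: eq_bigr => l _; rewrite !mxE mulrC.
have id_G : @ghom F G P P 1%:M by move=> i; rewrite mulmx1 mul1mx.
have [h hG rh] := projP (big_dsum (fun=> regular_mod G)) P r 1%:M rG surj_r id_G.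
by exists h, r.
Qed.

End GroupAlgebraAction.

Lemma jblockX (K : fieldType) s i :
  jblock K s ^+ i = \matrix_(a, b) (a == (b + i)%N :> nat)%:R.
Proof.
elim: i => [|i IHi].
  by apply/matrixP => a b; rewrite expr0 !mxE addn0.
apply/matrixP => a b; rewrite exprS IHi mxE.
have [lt_bi|le_bi] := ltnP (b + i) s.
  rewrite (bigD1 (Ordinal lt_bi)) //= big1 ?addr0 => [|j].
    by rewrite !mxE eqxx mulr1 addnS.
  by rewrite -val_eqE !mxE /= => /negPf->; rewrite mulr0.
rewrite mxE [_ == _]negbTE; last by have := ltn_ord a; lia.
rewrite big1 // => j _; rewrite !mxE [_ == (_ + _)%N]negbTE ?mulr0 //.
by have := ltn_ord j; lia.
Qed.

(** Flatness tested on the inclusion f of [1] in [p] as the socle.  If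
    T^(p-1) v = 0, then f(1) (x) v = t^(p-1) (x) v = 1 (x) T^(p-1) v vanishes in
    [p] (x) V, so 1 (x) v vanishes in [1] (x) V = V / T V. *)
Lemma flat_free (K : fieldType) p n (T : 'M[K]_n) :
  (1 < p)%N -> T ^+ p = 0 -> flat p T -> free_op p T.
Proof.
move=> p_gt1 Tp0 flatT; split=> // v Tv.
pose f : 'M[K]_(p, 1) := \col_i (i == p.-1 :> nat)%:R.
have lt_p1 : (p.-1 < p)%N by lia.
have := flatT 1%N p 0 (jblock K p) f; case/(_ _ _ _ _ v^T).
- by rewrite expr0n; case: (p) p_gt1.
- rewrite jblockX; apply/matrixP => i j; rewrite !mxE [_ == _]negbTE //.
  by have := ltn_ord i; lia.
- rewrite mulmx0; apply/matrixP => i j; rewrite !mxE big1 // => l _.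
  rewrite !mxE; have [l_p|] := eqVneq (l : nat) p.-1; last by rewrite mulr0.
  by rewrite [_ == _]negbTE ?mul0r //; have := ltn_ord i; lia.
- move=> w /matrixP/(_ (Ordinal lt_p1) 0); rewrite !mxE big_ord1 !mxE eqxx mul1r.
  by move=> w0; apply/matrixP => i j; rewrite !ord1 w0 mxE.
(* The witness moves the powers of t one at a time across the tensor
   product: row i holds T^(p-2-i) v for i < p-1, and the last row is 0. *)
- pose w (i : nat) : 'cV_n := if (i == p.-1)%N then 0 else T ^+ (p.-2 - i) *m v.
  exists (\matrix_(i, j) w i j 0); apply/matrixP => i j.
  rewrite [RHS]mxE [X in _ = _ + X]mxE.
  have -> : ((\matrix_(i < p, j < n) w i j 0) *m T^T) i j = (T *m w i) j 0.
    by rewrite !mxE; apply: eq_bigr => l _; rewrite !mxE mulrC.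
  have -> : (jblock K p *m \matrix_(i < p, j < n) w i j 0) i j =
            if (i == 0 :> nat)%N then 0 else w i.-1 j 0.
    rewrite mxE; case: ifP => [i0|i0].
      by rewrite big1 // => l _; rewrite mxE (eqP i0) mul0r.
    have lt_i : (i.-1 < p)%N by have := ltn_ord i; lia.
    rewrite (bigD1 (Ordinal lt_i)) //= !mxE big1 ?addr0 => [|l].
      by rewrite (_ : (i == i.-1.+1 :> nat)) ?mul1r //; lia.
    rewrite -val_eqE !mxE /= => l_i; rewrite [_ == _]negbTE ?mul0r //; lia.
  rewrite [LHS]mxE big_ord1 [f _ _]mxE [v^T _ _]mxE /w.
  have [ip | ip] := eqVneq (i : nat) p.-1.
    rewrite /= mulmx0 mxE subr0 mul1r ifF ?ifF; try lia.
    by rewrite (_ : p.-2 - i.-1 = 0)%N ?expr0 ?mul1mx; last lia.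
  rewrite /= mul0r mul_expmxS; have lt_i := ltn_ord i.
  have [i0 | i0] := eqVneq (i : nat) 0%N.
    by rewrite (_ : (p.-2 - i).+1 = p.-1) ?Tv ?mxE ?subr0; last lia.
  rewrite ifF; last lia.
  by rewrite (_ : p.-2 - i.-1 = (p.-2 - i).+1)%N ?subrr; last lia.
move=> W DW; exists (- W^T); rewrite mulmxN; apply: trmx_inj.
by rewrite DW mul0mx sub0r !linearN /= trmx_mul trmxK.
Qed.

(** * Restriction along a pi-point *)

Section Restriction.
Variables (k K : fieldType) (iota : {rmorphism k -> K}) (G : fgscheme k).
Variable x : 'rV[K]_(gdim (base_change iota G)).
Implicit Types M N P : gmod G.

Lemma ghom_restriction M N (f : 'M_(mdim N, mdim M)) : ghom f ->
  map_mx iota f *m restriction x M = restriction x N *m map_mx iota f.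
Proof.
move=> fG.
apply: (@ghom_kgact _ _ (base_change_mod iota M) (base_change_mod iota N)).
by move=> i; rewrite /= -!map_mxM fG.
Qed.

Lemma restriction_regular :
  restriction x (regular_mod G) = kgact (regular_mod (base_change iota G)) x.
Proof.
apply: eq_bigr => i _; congr (_ *: _).
by apply/matrixP => a b; rewrite !mxE.
Qed.

Variable p : nat.
Hypotheses (p_gt1 : (1 < p)%N) (pi_x : pi_point p x).

Lemma restriction_nilp M : restriction x M ^+ p = 0.
Proof.
case: pi_x => xp0 _ _.
exact: (@kgact_nilp _ _ (base_change_mod iota M) x p xp0).
Qed.

Lemma restriction_projective P : projective P -> free_op p (restriction x P).
Proof.
move=> /projective_retract[i [r [iG rG ri]]].
have [_ flat_x _] := pi_x.
apply: (free_op_retract (ghom_restriction iG) (ghom_restriction rG)).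
  by rewrite -map_mxM ri map_mx1.
pose d := fun _ : 'I_(mdim P) => gdim G.
apply: (@free_op_direct_sum _ p _ _ d _ (fun j => restriction x (regular_mod G))
  (fun j => map_mx iota (block_inj k d j)) (fun j => map_mx iota (block_proj k d j))).
- move=> j; apply: (@ghom_restriction (regular_mod G)
    (big_dsum (fun=> regular_mod G)) (block_inj k d j)) => l.
  exact: (@mxdiag_block_inj _ _ d (fun=> mact (regular_mod G) l)).
- move=> j; apply: (@ghom_restriction
    (big_dsum (fun=> regular_mod G)) (regular_mod G) (block_proj k d j)) => l.
  exact: (@mxdiag_block_proj _ _ d (fun=> mact (regular_mod G) l)).
- have := congr1 (map_mx iota) (block_inj_proj k d).
  rewrite map_mx1 map_mx_sum => <-; apply: eq_bigr => j _.
  exact/esym/map_mxM.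
move=> j; apply: (flat_free p_gt1 (restriction_nilp (regular_mod G))).
by rewrite restriction_regular.
Qed.

End Restriction.

(** * Heller shifts and Tate classes at a pi-point *)

Section PiPoint.
Variables (p : nat) (k : fieldType) (G : fgscheme k) (R : complete_res G).
Variables (K : fieldType) (iota : {rmorphism k -> K}).
Variable x : 'rV[K]_(gdim (base_change iota G)).
Variable th : forall i : int, 'M[K]_(mdim (Pr R i), p).
Hypotheses (p_gt1 : (1 < p)%N) (pi_x : pi_point p x) (th_comp : comparison x th).

Local Notation "f ^i" := (map_mx iota f) (at level 2, format "f ^i").
Local Notation T M := (restriction x M).

(** The differential from degree i + 1 to degree i of the periodic resolution is
    t to this power, and Omega^i restricts to the block of this size plus a free
    module. *)
Definition diff_exp (i : int) : nat := if (2 %| i)%Z then 1 else p.-1.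

Lemma diff_exp_bounds i : (0 < diff_exp i < p)%N.
Proof. by rewrite /diff_exp; case: ifP => _; lia. Qed.

Lemma diff_exp_opp u v : ~~ (2 %| u - v)%Z -> diff_exp u = (p - diff_exp v)%N.
Proof. by rewrite /diff_exp; do 2!case: ifP; lia. Qed.

Lemma diff_expS i : diff_exp (i + 1) = (p - diff_exp i)%N.
Proof. by apply: diff_exp_opp; lia. Qed.

Definition kt_one : 'cV[K]_p := \col_s (s == 0 :> nat)%:R.
Definition base_elt i : 'cV_(mdim (Pr R i)) := th i *m kt_one.
Definition heller_elt i : 'cV_(mdim (Om R i)) := (cov R i)^i *m base_elt i.

Lemma base_elt_diff i :
  (diff R i)^i *m base_elt (i + 1) = T (Pr R i) ^+ diff_exp i *m base_elt i.
Proof.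
have [th_t th_d _] := th_comp.
rewrite /base_elt mulmxA -th_d mulmxA; congr (_ *m _).
have -> : kt_diff p K i = jblock K p ^+ diff_exp i.
  by rewrite /kt_diff /diff_exp; case: ifP.
exact: intertwineX.
Qed.

Lemma exact_restriction M N P (f : 'M_(mdim N, mdim M)) (g : 'M_(mdim P, mdim N)) :
  @short_exact k G M N P f g -> exact_pair f^i g^i.
Proof. by case=> _ _ inj_f surj_g fg; apply: exact_pair_map. Qed.

Lemma inc_heller_elt i :
  (inc R i)^i *m heller_elt (i + 1) = T (Pr R i) ^+ diff_exp i *m base_elt i.
Proof. by rewrite /heller_elt mulmxA -map_mxM base_elt_diff. Qed.

Lemma free_Pr i : free_op p (T (Pr R i)).
Proof. exact/restriction_projective/res_proj. Qed.

(** A nilpotent scalar is zero. *)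
Lemma trivial_restriction : T (trivial_mod G) = 0.
Proof.
have := restriction_nilp pi_x (trivial_mod G).
have [a ->] : exists a, T (trivial_mod G) = a%:M :> 'M_1.
  by eexists; apply: (@mx11_scalar _ (T (trivial_mod G))).
have -> : a%:M ^+ p = (a ^+ p)%:M :> 'M_1 by rewrite rmorphXn.
move=> /matrixP/(_ 0 0); rewrite !mxE eqxx => /eqP; rewrite expf_eq0.
by case/andP => _ /eqP ->; apply/matrixP => i j; rewrite !mxE mul0rn.
Qed.

Lemma aug_heller_elt : (aug R)^i *m heller_elt 0 = 1%:M.
Proof.
have [_ _ th0] := th_comp.
rewrite /heller_elt /base_elt !mulmxA -map_mxM th0.
apply/matrixP => i j; rewrite !ord1 !mxE.
have p_gt0 : (0 < p)%N by lia.
rewrite (bigD1 (Ordinal p_gt0)) //= !mxE eqxx mulr1 big1 ?addr0 // => s.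
by rewrite -val_eqE !mxE => /negPf ->; rewrite mulr0.
Qed.

Lemma restriction_Om0 : T (Om R 0) = 0.
Proof.
have [augG [g [_ gaug]]] := res_aug R.
rewrite -[LHS]mul1mx -(map_mx1 iota) -gaug map_mxM -mulmxA.
by rewrite (ghom_restriction _ augG) trivial_restriction mul0mx mulmx0.
Qed.

Lemma stable_blocks_Om0 : stable_blocks p (diff_exp 0) (T (Om R 0)) (heller_elt 0).
Proof.
have [augG [g [auggK gaug]]] := res_aug R.
have allE (v : 'cV_(mdim (Om R 0))) : v = heller_elt 0 *m ((aug R)^i *m v).
  rewrite -[LHS]mul1mx -[heller_elt 0]mul1mx -(map_mx1 iota) -gaug map_mxM.
  rewrite -[_ *m heller_elt 0]mulmxA aug_heller_elt mulmx1 mulmxA //.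
rewrite /diff_exp /=; split; rewrite ?expr1 ?expr0 ?restriction_Om0 ?mul0mx //.
- move=> v _; exists 0, ((aug R)^i *m v).
  by rewrite mulmx0 add0r -allE.
- move=> v _; exists 0, ((aug R)^i *m v).
  by rewrite mulmx0 add0r mul1mx -allE.
move=> a y; rewrite mul0mx mul1mx => /(congr1 (mulmx (aug R)^i)).
by rewrite mulmxA aug_heller_elt mul1mx mulmx0.
Qed.

(** Dimension shifting in both directions from degree 0. *)
Lemma stable_blocks_Om i : stable_blocks p (diff_exp i) (T (Om R i)) (heller_elt i).
Proof.
pose P i := stable_blocks p (diff_exp i) (T (Om R i)) (heller_elt i).
have PS j : P j <-> P (j + 1).
  have [incG covG _ _ _] := res_exact R j.
  have ex_j := exact_restriction (res_exact R j).
  have [incT covT] := (ghom_restriction x incG, ghom_restriction x covG).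
  rewrite /P diff_expS; split.
    exact: (stable_blocks_syzygy incT covT ex_j (free_Pr j)
      (diff_exp_bounds j) (inc_heller_elt j)).
  exact: (stable_blocks_quotient incT covT ex_j (free_Pr j)
    (diff_exp_bounds j) (inc_heller_elt j)).
elim/int_rect: i => [|n IHn|n IHn]; first exact: stable_blocks_Om0.
  by rewrite -addn1 PoszD; apply: (PS n%:Z).1 IHn.
by apply: (PS (- n.+1%:Z)).2; rewrite -addn1 PoszD opprD subrK.
Qed.

Section ChainMap.
Variables (d : int) (f : forall u v : int, 'M[k]_(mdim (Pr R v), mdim (Pr R u))).
Hypotheses (fd : chain_map d f) (d_odd : ~~ (2 %| d)%Z).

(** The chain map sends the generator in degree u to c times the generator of
    Omega^v (v even), or to c times its socle (v odd), modulo the image of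
    T^(diff_exp v). *)
Definition chain_coef (u v : int) (c : K) : Prop := exists y,
  (cov R v)^i *m ((f u v)^i *m base_elt u) =
  c *: (T (Om R v) ^+ (diff_exp v).-1 *m heller_elt v) + T (Om R v) ^+ diff_exp v *m y.

(* As d is odd, multiplication by T^(p - diff_exp v) on the target lifts the
   differential of the periodic resolution in degree u. *)
Let chain_shift u v : u - v = d ->
  T (Pr R v) ^+ (p - diff_exp v) *m ((f u v)^i *m base_elt u) =
  (inc R v)^i *m ((cov R (v + 1))^i *m ((f (u + 1) (v + 1))^i *m base_elt (u + 1))).
Proof.
move=> uv; have [fG fdiff] := fd uv.
rewrite -(intertwineXv _ _ (ghom_restriction x fG)).
rewrite -(@diff_exp_opp u v) ?uv // -base_elt_diff mulmxA -map_mxM -fdiff.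
by rewrite /diff !map_mxM !mulmxA.
Qed.

(** Multiplying the relation in degree v by T^(p - diff_exp v) lands in
    Omega^(v+1), where it is the relation in degree v + 1 with the same c. *)
Lemma chain_coefS u v c : u - v = d -> chain_coef u v c -> chain_coef (u + 1) (v + 1) c.
Proof.
move=> uv [y Dy].
have [incG covG _ _ _] := res_exact R v.
have [inj_inc surj_cov exact_v] := exact_restriction (res_exact R v).
have [Y DY] := surj_cov y.
have [Tp0 _] := free_Pr v.
have /andP[v_gt0 v_ltp] := diff_exp_bounds v.
set P := T (Pr R v) in Tp0.
have /exact_v[q Dq] : (cov R v)^i *m ((f u v)^i *m base_elt u -
    (c *: (P ^+ (diff_exp v).-1 *m base_elt v) + P ^+ diff_exp v *m Y)) = 0.
  rewrite mulmxBr Dy mulmxDr -scalemxAr !(intertwineXv _ _ (ghom_restriction x covG)).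
  by rewrite DY subrr.
exists q.
apply: (inj_mx_cancel inj_inc); rewrite -chain_shift // diff_expS mulmxDr -scalemxAr.
rewrite !(intertwineXv _ _ (ghom_restriction x incG)) inc_heller_elt -/P.
rewrite -Dq !mulmxBr !mulmxDr -!scalemxAr !mul_expmxD -/P.
have -> : (p - diff_exp v + (diff_exp v).-1 = (p - diff_exp v).-1 + diff_exp v)%N by lia.
rewrite (mul_expmx_ge (i := p - diff_exp v + diff_exp v) _ Tp0); last lia.
by rewrite addr0 addrC subrK.
Qed.

Lemma chain_coef_add u v c (n : nat) : u - v = d ->
  chain_coef u v c -> chain_coef (u + n%:Z) (v + n%:Z) c.
Proof.
move=> uv uvc; elim: n => [|n IHn]; first by rewrite !addr0.
rewrite -addn1 PoszD !addrA; apply: chain_coefS => //.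
by rewrite opprD addrACA subrr addr0.
Qed.

Lemma chain_coef_exists u v : u - v = d -> exists c, chain_coef u v c.
Proof.
move=> uv; have [_ covG _ _ _] := res_exact R v.
have [_ _ ker2 _] := stable_blocks_Om v.
have [|y [a Da]] := ker2 ((cov R v)^i *m ((f u v)^i *m base_elt u)).
  rewrite -(intertwineXv _ _ (ghom_restriction x covG)) chain_shift //.
  have [_ _ exact_v] := exact_restriction (res_exact R v).
  by apply/exact_v; eexists.
exists (a 0 0), y; rewrite Da addrC; congr (_ + _).
by rewrite [in LHS](mx11_scalar a) mul_mx_scalar -scalemxAr.
Qed.

Lemma chain_coef_uniq u v c c' : chain_coef u v c -> chain_coef u v c' -> c = c'.
Proof.
move=> [y Dy] [y']; rewrite {}Dy => Dc.
have [_ _ _ indep] := stable_blocks_Om v.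
suff /indep/matrixP/(_ 0 0) :
    T (Om R v) ^+ (diff_exp v).-1 *m (heller_elt v *m (c - c')%:M) =
    T (Om R v) ^+ diff_exp v *m (y' - y).
  by rewrite !mxE eqxx => /eqP; rewrite subr_eq0 => /eqP.
rewrite mul_mx_scalar -scalemxAr scalerBl mulmxBr (canRL (addrK _) Dc) addrAC.
by rewrite [c' *: _ + _]addrC addrK.
Qed.

End ChainMap.

(** The coefficient of a chain map extending zh is computed in target degree b by
    zh and in target degree 0 by z: a map through a projective Q sends the
    generator of [p-1] into T Q, hence to 0 in the trivial module. *)
Lemma represents_heller_elt a b (zh : 'M_(mdim (Om R b), mdim (Om R a)))
    (z : 'M_(mdim (trivial_mod G), mdim (Om R (a - b)))) :
  ~~ (2 %| a - b)%Z -> (2 %| b)%Z -> represents zh z ->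
  exists y, zh^i *m heller_elt a =
    restriction_coef iota th z *: heller_elt b + T (Om R b) *m y.
Proof.
move=> ab_odd b_even [f [w [fd Dzh Dw wz]]].
set c := restriction_coef iota th z.
have coef0 : chain_coef f (a - b) 0 c.
  have abE : a - b - 0 = a - b by rewrite subr0.
  have [c0 c0P] := chain_coef_exists fd ab_odd abE.
  suff -> : c = c0 by [].
  case: c0P => y; rewrite /diff_exp /= restriction_Om0 expr0 expr1 mul1mx mul0mx addr0.
  move=> /(congr1 (mulmx (aug R)^i)); rewrite -scalemxAr aug_heller_elt.
  have -> : (aug R)^i *m ((cov R 0)^i *m ((f (a - b) 0)^i *m base_elt (a - b))) =
            w^i *m heller_elt (a - b).
    by rewrite /heller_elt !mulmxA -!map_mxM Dw.
  move=> wE.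
  have cE : z^i *m heller_elt (a - b) = c%:M.
    by rewrite [LHS]mx11_scalar; rewrite /c /restriction_coef map_mxM -!mulmxA.
  have [Q [al [be [projQ alG beG wzE]]]] := wz.
  have [hel0 _ _ _] := stable_blocks_Om (a - b).
  have [|q Dq] := (restriction_projective p_gt1 pi_x projQ).2 (al^i *m heller_elt (a - b)).
    rewrite -(intertwineXv _ _ (ghom_restriction x alG)).
    by move: hel0; rewrite /diff_exp (negPf ab_odd) => ->; rewrite mulmx0.
  have : (w - z)^i *m heller_elt (a - b) = 0.
    rewrite wzE map_mxM -mulmxA Dq mulmxA (ghom_restriction x beG).
    by rewrite trivial_restriction !mul0mx.
  rewrite map_mxB mulmxBl wE cE => /eqP; rewrite subr_eq0 => /eqP/matrixP/(_ 0 0).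
  by rewrite !mxE eqxx mulr1.
suff [y] : chain_coef f a b c.
  rewrite /diff_exp b_even expr0 expr1 mul1mx mulmxA -map_mxM Dzh map_mxM -mulmxA.
  by move=> Dy; exists y.
(* Coefficients propagate upwards only, so start from the smaller of 0 and b. *)
have [b_ge0 | b_lt0] : (exists n : nat, b = n) \/ (exists n : nat, b = - n%:Z).
- by case: b {zh z ab_odd b_even Dzh Dw wz c coef0 fd f w} => n;
    [left; exists n | right; exists n.+1].
- have [n Dn] := b_ge0.
  have := @chain_coef_add _ _ fd ab_odd (a - b) 0 c n (subr0 _) coef0.
  by rewrite -Dn subrK add0r.
have [n Dn] := b_lt0.
have [c' c'P] := chain_coef_exists fd ab_odd (erefl (a - b)).
have := @chain_coef_add _ _ fd ab_odd a b c' n (erefl _) c'P.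
have -> : b + n%:Z = 0 by rewrite Dn addNr.
have -> : a + n%:Z = a - b by rewrite Dn opprK.
by move=> /(chain_coef_uniq coef0) ->.
Qed.

End PiPoint.

(** * Direct sums of modules at a pi-point *)

Section DirectSumModules.
Variables (F : fieldType) (G : fgscheme F).

Lemma ghom_big_dsum_inj n (Ms : 'I_n -> gmod G) j :
  @ghom F G (Ms j) (big_dsum Ms) (block_inj F (fun j => mdim (Ms j)) j).
Proof. by move=> i; apply: mxdiag_block_inj. Qed.

Lemma ghom_big_dsum_proj n (Ms : 'I_n -> gmod G) j :
  @ghom F G (big_dsum Ms) (Ms j) (block_proj F (fun j => mdim (Ms j)) j).
Proof. by move=> i; apply: mxdiag_block_proj. Qed.

Lemma ghom_dsum_inl (M N : gmod G) : @ghom F G M (dsum M N) (col_mx 1%:M 0).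
Proof.
by move=> i; rewrite mul_block_col mul_col_mx !mul0mx !mulmx0 mulmx1 mul1mx !addr0.
Qed.

Lemma ghom_dsum_inr (M N : gmod G) : @ghom F G N (dsum M N) (col_mx 0 1%:M).
Proof.
by move=> i; rewrite mul_block_col mul_col_mx !mul0mx !mulmx0 mulmx1 mul1mx !add0r.
Qed.

Lemma ghom_dsum_fst (M N : gmod G) : @ghom F G (dsum M N) M (row_mx 1%:M 0).
Proof.
by move=> i; rewrite mul_row_block mul_mx_row !mul0mx !mulmx0 mulmx1 mul1mx !addr0.
Qed.

Lemma ghom_dsum_snd (M N : gmod G) : @ghom F G (dsum M N) N (row_mx 0 1%:M).
Proof.
by move=> i; rewrite mul_row_block mul_mx_row !mul0mx !mulmx0 mulmx1 mul1mx !add0r.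
Qed.

End DirectSumModules.

Section BlocksOfSums.
Variables (k K : fieldType) (iota : {rmorphism k -> K}) (G : fgscheme k).
Variables (x : 'rV[K]_(gdim (base_change iota G))) (p : nat).
Hypotheses (p_gt1 : (1 < p)%N) (pi_x : pi_point p x).
Variables (n s : nat) (Ms : 'I_n -> gmod G).
Variable u : forall j, 'cV[K]_(mdim (Ms j)).
Hypotheses (s_p : (0 < s < p)%N).
Hypothesis blk : forall j, stable_blocks p s (restriction x (Ms j)) (u j).

Local Notation d := (fun j => mdim (Ms j)).

Lemma stable_blocks_iso_big_dsum M (f : 'M[k]_(mdim M, mdim (big_dsum Ms))) :
  giso f ->
  stable_blocks p s (restriction x M)
    (\matrix_(i, j) (map_mx iota (f *m block_inj k d j) *m u j) i 0).
Proof.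
case=> fG [g [fg gf]]; have gG := ghom_inverse fG (conj fg gf).
apply: (@stable_blocks_direct_sum _ p s n _ 0 d _ (fun j => restriction x (Ms j)) 0 u
  (fun j => map_mx iota (f *m block_inj k d j))
  (fun j => map_mx iota (block_proj k d j *m g)) 0 0) => //.
- by move=> j; apply: ghom_restriction; apply: ghom_mul fG; apply: ghom_big_dsum_inj.
- by move=> j; apply: ghom_restriction; apply: ghom_mul gG _; apply: ghom_big_dsum_proj.
- by rewrite mul0mx mulmx0.
- by rewrite mul0mx mulmx0.
- move=> j; rewrite -map_mxM -mulmxA [g *m _]mulmxA gf mul1mx block_injK.
  exact: map_mx1.
- move=> i j ij; rewrite -map_mxM -mulmxA [g *m _]mulmxA gf mul1mx.
  by rewrite block_inj_ortho // map_mx0.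
- have := congr1 (map_mx iota) (congr1 (fun X => f *m X *m g) (block_inj_proj k d)).
  rewrite mulmx1 fg map_mx1 mulmx_sumr mulmx_suml map_mx_sum mul0mx addr0 => <-.
  by apply: eq_bigr => j _; rewrite -map_mxM !mulmxA.
split=> [|v _]; first by apply/matrixP => [[]].
by exists 0; apply/matrixP => [[]].
Qed.

Lemma stable_blocks_iso_dsum M Q (f : 'M[k]_(mdim M, mdim (dsum (big_dsum Ms) Q))) :
  giso f -> projective Q ->
  stable_blocks p s (restriction x M)
    (\matrix_(i, j) (map_mx iota (f *m col_mx (block_inj k d j) 0) *m u j) i 0).
Proof.
case=> fG [g [fg gf]] projQ; have gG := ghom_inverse fG (conj fg gf).
have inlE j :
    col_mx (block_inj k d j) 0 = col_mx 1%:M 0 *m block_inj k d j :> 'M_(_ + mdim Q, _).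
  by rewrite mul_col_mx mul1mx mul0mx.
have fstE j :
    row_mx (block_proj k d j) 0 = block_proj k d j *m row_mx 1%:M 0 :> 'M_(_, _ + mdim Q).
  by rewrite mul_mx_row mulmx1 mulmx0.
apply: (@stable_blocks_direct_sum _ p s n _ (mdim Q) d _ (fun j => restriction x (Ms j))
  (restriction x Q) u
  (fun j => map_mx iota (f *m col_mx (block_inj k d j) 0))
  (fun j => map_mx iota (row_mx (block_proj k d j) 0 *m g))
  (map_mx iota (f *m col_mx 0 1%:M)) (map_mx iota (row_mx 0 1%:M *m g))) => //.
- move=> j; apply: ghom_restriction; apply: ghom_mul fG; rewrite inlE.
  by apply: ghom_mul (ghom_dsum_inl _ _); apply: ghom_big_dsum_inj.
- move=> j; apply: ghom_restriction; apply: ghom_mul gG _; rewrite fstE.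
  by apply: ghom_mul (ghom_dsum_fst _ _) _; apply: ghom_big_dsum_proj.
- by apply: ghom_restriction; apply: ghom_mul fG; apply: ghom_dsum_inr.
- by apply: ghom_restriction; apply: ghom_mul gG _; apply: ghom_dsum_snd.
- move=> j; rewrite -map_mxM -mulmxA [g *m _]mulmxA gf mul1mx mul_row_col.
  by rewrite block_injK mul0mx addr0 map_mx1.
- move=> i j ij; rewrite -map_mxM -mulmxA [g *m _]mulmxA gf mul1mx mul_row_col.
  by rewrite block_inj_ortho // mul0mx addr0 map_mx0.
- have sum1 : \sum_j f *m col_mx (block_inj k d j) 0 *m (row_mx (block_proj k d j) 0 *m g)
      + f *m col_mx 0 1%:M *m (row_mx 0 1%:M *m g) = 1%:M.
    transitivity
      (f *m (col_mx 1%:M 0 *m row_mx 1%:M 0 + col_mx 0 1%:M *m row_mx 0 1%:M) *m g).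
      rewrite mulmxDr mulmxDl !mulmxA; congr (_ + _).
      set inl := col_mx _ _; set fst := row_mx _ _.
      rewrite -[f *m inl]mulmx1 -(block_inj_proj k d) mulmx_sumr !mulmx_suml.
      by apply: eq_bigr => j _; rewrite inlE fstE !mulmxA.
    rewrite !mul_col_row !mul1mx !mul0mx ?mulmx0 add_block_mx !addr0 !add0r.
    by rewrite -scalar_mx_block mulmx1.
  have := congr1 (map_mx iota) sum1; rewrite map_mx1 map_mxD map_mx_sum => <-.
  congr (_ + _); last exact/esym/map_mxM.
  by apply: eq_bigr => j _; apply/esym/map_mxM.
exact: restriction_projective.
Qed.

End BlocksOfSums.

(** * The Jordan type of L at every pi-point *)

Theorem proposition7p7 (p : nat) (k : fieldType)
    (hchar : p \in [pchar k]) (hp : (2 < p)%N)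
    (G : fgscheme k) (R : complete_res G)
    (m n : nat) (hn : (0 < n)%N) (hmn : (n < m)%N)
    (md : 'I_m -> int) (nd : 'I_n -> int)
    (hmd : forall j, ~~ (2 %| md j)%Z) (hnd : forall i, (2 %| nd i)%Z)
    (* homomorphisms Om (md j - nd i) -> k, giving the Tate classes *)
    (zeta : forall (i : 'I_n) (j : 'I_m),
      'M[k]_(mdim (trivial_mod G), mdim (Om R (md j - nd i))))
    (hzeta : forall i j, ghom (zeta i j))
    (zhat : forall (i : 'I_n) (j : 'I_m),
      'M[k]_(mdim (Om R (nd i)), mdim (Om R (md j))))
    (hzhat : forall i j, ghom (zhat i j))
    (hrep : forall i j, represents (zhat i j) (zeta i j))
    (* the exact sequence 0 -> L -> M -> N -> 0 *)
    (L M N : gmod G)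
    (incl : 'M[k]_(mdim M, mdim L)) (phi : 'M[k]_(mdim N, mdim M))
    (hexact : short_exact incl phi)
    (* the isomorphisms identifying M and N with the sums of Heller shifts *)
    (Q : gmod G) (hQ : projective Q)
    (isoM : 'M[k]_(mdim M, mdim (dsum (big_dsum (fun j => Om R (md j))) Q)))
    (hisoM : giso isoM)
    (isoN : 'M[k]_(mdim N, mdim (big_dsum (fun i => Om R (nd i)))))
    (hisoN : giso isoN)
    (phiQ : 'M[k]_(mdim (big_dsum (fun i => Om R (nd i))), mdim Q))
    (hphi : phi *m isoM =
            isoN *m row_mx (\mxblock_(i < n, j < m) zhat i j) phiQ)
    (hrank : forall (K : fieldType) (iota : {rmorphism k -> K})
        (x : 'rV[K]_(gdim (base_change iota G))),
      pi_point p x ->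
      exists2 th, @comparison p k G R K iota x th &
        \rank (\matrix_(i < n, j < m) restriction_coef iota th (zeta i j)) = n) :
  stable_constant_jordan_type p L
    (fun s => if s == p.-1 then (m - n)%N else if s == p.-2 then n else 0%N).
Proof.
have p_gt1 : (1 < p)%N by lia.
pose q := ((mdim L - ((m - n) * p.-1 + n * p.-2)) %/ p)%N.
exists (fun s => if s == p.-1 then (m - n)%N else if s == p.-2 then n
                 else (q * (s == p))%N); last first.
  by move=> i /andP[_ ltip]; rewrite (ltn_eqF ltip) muln0.
move=> K iota x pi_x; have [th th_comp rank_zeta] := hrank K iota x pi_x.
have [inclG phiG inj_incl surj_phi exact_ip] := hexact.
set C := \matrix_(i, j) _ in rank_zeta.
pose u i := heller_elt iota th i.
have blkOm := stable_blocks_Om p_gt1 pi_x th_comp.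
have blkM : stable_blocks p p.-1 (restriction x M) (\matrix_(i, j) (map_mx iota
    (isoM *m col_mx (block_inj k (fun j => mdim (Om R (md j))) j) 0) *m u (md j)) i 0).
  apply: (stable_blocks_iso_dsum p_gt1 pi_x _ _ hisoM hQ); first by lia.
  by move=> j; have := blkOm (md j); rewrite /diff_exp (negPf (hmd j)).
have blkN : stable_blocks p 1 (restriction x N) (\matrix_(i, j) (map_mx iota
    (isoN *m block_inj k (fun i => mdim (Om R (nd i))) j) *m u (nd j)) i 0).
  apply: (stable_blocks_iso_big_dsum _ _ hisoN); first by lia.
  by move=> i; have := blkOm (nd i); rewrite /diff_exp (hnd i).
set U := \matrix_(_, _) _ in blkM; set W := \matrix_(_, _) _ in blkN.
have [isoNG _] := hisoN.
have [Y DY] : exists Y, restriction x N *m Y = map_mx iota phi *m U - W *m C.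
  apply: matrix_of_columns => j.
  have /fin_all_exists[y Dy] : forall i, exists y,
      map_mx iota (zhat i j) *m u (md j) =
      C i j *: u (nd i) + restriction x (Om R (nd i)) *m y.
    move=> i; rewrite mxE; apply: (represents_heller_elt p_gt1 pi_x th_comp) => //.
    by have := hmd j; have := hnd i; lia.
  exists (\sum_i map_mx iota (isoN *m block_inj k (fun i => mdim (Om R (nd i))) i) *m y i).
  pose inN i := block_inj k (fun i => mdim (Om R (nd i))) i.
  have phi_in : phi *m (isoM *m col_mx (block_inj k (fun j => mdim (Om R (md j))) j) 0) =
      isoN *m \sum_i inN i *m zhat i j.
    rewrite mulmxA hphi -mulmxA mul_row_col mulmx0 addr0.
    by rewrite -mxblock_block_inj.
  (* Column j of phi U collects the images zhat i j u_(md j), each congruent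
     to C i j u_(nd i) modulo the image of T. *)
  have -> : col j (map_mx iota phi *m U - W *m C) =
      \sum_i map_mx iota (isoN *m inN i) *m
        (map_mx iota (zhat i j) *m u (md j) - C i j *: u (nd i)).
    rewrite linearB /= colE -mulmxA -colE [X in _ - X]colE -mulmxA -colE.
    under [RHS]eq_bigr do rewrite mulmxBr.
    rewrite sumrB; congr (_ - _).
      have -> : col j U =
          map_mx iota (isoM *m col_mx (block_inj k (fun j => mdim (Om R (md j))) j) 0)
                    *m u (md j).
        by apply/colP => i; rewrite !mxE.
      rewrite mulmxA -map_mxM phi_in mulmx_sumr map_mx_sum mulmx_suml.
      by apply: eq_bigr => i _; rewrite !map_mxM -!mulmxA.
    rewrite mulmx_sum_col; apply: eq_bigr => i _; rewrite !mxE -scalemxAr.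
    by congr (_ *: _); apply/colP => l; rewrite !mxE.
  rewrite mulmx_sumr; apply: eq_bigr => i _.
  have inG : ghom (isoN *m inN i).
    by apply: ghom_mul isoNG; apply: ghom_big_dsum_inj.
  rewrite mulmxA -(ghom_restriction x inG) -mulmxA; congr (_ *m _).
  by rewrite Dy addrC addKr.
apply: (jordan_type_kernel (Y := Y) hp _ _ _ _ blkM blkN _ rank_zeta).
- exact: ghom_restriction inclG.
- exact: ghom_restriction phiG.
- exact: exact_restriction hexact.
- exact: restriction_nilp.
- by rewrite DY addrC subrK.
Qed.
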